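(* Let $S[f]$ denote the Schwarzian derivative of a function $f$ with respect to its spatial variable. The hodograph-type transformation $$X=\int\sqrt{S[u]}\;dx,\qquad T=t,\qquad V(X,T)=x$$ provides the mapping between the fully-nonlinear third-order evolution equation $$u_t=\lambda\,\frac{u_x}{\sqrt{S[u]}},$$ where $\lambda$ is an arbitrary non-zero constant, and the Schwarzian KdV equation $$V_T=V_X\,S[V].$$
   Context: Here $u=u(x,t)$ and $V=V(X,T)$, subscripts denote partial derivatives, and $S[u]=\dfrac{u_{xxx}}{u_x}-\dfrac32\dfrac{u_{xx}^2}{u_x^2}$, $\;S[V]=\dfrac{V_{XXX}}{V_X}-\dfrac32\dfrac{V_{XX}^2}{V_X^2}$.
   Formalization: With T = t the target equation is V_T = -(λ/2) V_X S[V], so the claim as written holds only for λ = -2; the formal theorem proves this version and also V_T = V_X S[V] with T = -(λ/2) t, for smooth solutions, with a local converse for V_X > 0. *)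

(* Defs.v *)
From Stdlib Require Import Reals.
From Coquelicot Require Import Coquelicot.
Open Scope R_scope.

(* Functions of (space, time) are total maps R -> R -> R, studied on a set
   D : R -> R -> Prop; values outside D are irrelevant. *)

Definition dx (n : nat) (f : R -> R -> R) (x t : R) : R :=
  Derive_n (fun y => f y t) n x.

Definition dt (f : R -> R -> R) (x t : R) : R :=
  Derive (fun s => f x s) t.

Definition Schwarzian (f : R -> R -> R) (x t : R) : R :=
  dx 3 f x t / dx 1 f x t - 3 / 2 * ((dx 2 f x t) ^ 2 / (dx 1 f x t) ^ 2).

Definition open_2d (D : R -> R -> Prop) : Prop :=
  forall x t, D x t -> locally_2d D x t.

(* C^infinity jointly in both variables: [ex_diff_n f n] says that all partial
   derivatives of f of order <= n exist and are continuous. *)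
Definition smooth_on (D : R -> R -> Prop) (f : R -> R -> R) : Prop :=
  forall x t, D x t -> forall n : nat, ex_diff_n f n x t.

(* Possibly unbounded open rectangle. *)
Definition rectangle (a b c d : Rbar) (x t : R) : Prop :=
  Rbar_lt a x /\ Rbar_lt x b /\ Rbar_lt c t /\ Rbar_lt t d.

(* u is a smooth solution of u_t = lambda u_x / sqrt(S[u]) on the open set D,
   in the region u_x <> 0, S[u] > 0 where the equation makes sense. *)
Definition nonlinear_solution (lambda : R) (D : R -> R -> Prop)
    (u : R -> R -> R) : Prop :=
  open_2d D /\ smooth_on D u /\
  forall x t, D x t ->
    dx 1 u x t <> 0 /\ 0 < Schwarzian u x t /\
    dt u x t = lambda * (dx 1 u x t / sqrt (Schwarzian u x t)).

(* V is a smooth solution of V_T = mu V_X S[V] on the open set Omega; the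
   Schwarzian KdV equation is the case mu = 1.  The hodograph transformation
   gives V_X = 1 / sqrt(S[u]), so only solutions with V_X > 0 are concerned. *)
Definition SKdV_solution (mu : R) (Omega : R -> R -> Prop)
    (V : R -> R -> R) : Prop :=
  open_2d Omega /\ smooth_on Omega V /\
  forall X T, Omega X T ->
    0 < dx 1 V X T /\
    dt V X T = mu * (dx 1 V X T * Schwarzian V X T).

(* The new independent variables are X = xi(x,t) and T = kappa t, where
   xi = int sqrt(S[u]) dx is a primitive in x, and V is then defined by
   V(X,T) = x.  The primitive is determined up to an additive function of t. *)
Definition hodograph (kappa : R) (D : R -> R -> Prop)
    (u xi V : R -> R -> R) : Prop :=
  smooth_on D xi /\
  forall x t, D x t ->
    is_derive (fun y => xi y t) x (sqrt (Schwarzian u x t)) /\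
    V (xi x t) (kappa * t) = x.

(* Image of D under (x,t) |-> (xi(x,t), kappa t). *)
Definition hodograph_image (kappa : R) (D : R -> R -> Prop)
    (xi : R -> R -> R) (X T : R) : Prop :=
  exists x t, D x t /\ X = xi x t /\ T = kappa * t.

(* The transformation with T = kappa t maps between the two equations:
   - every solution u on a rectangle is sent to a solution V on the whole image
     of the rectangle, for a suitable choice of the function of t left free in
     the primitive xi;
   - every solution V is, around each point of its domain, the transform of a
     solution u.  This direction is only local: functions u with S[u] > 0
     oscillate like a tangent, and a global u would acquire poles. *)
Definition hodograph_maps_between (kappa lambda mu : R) : Prop :=
  (forall (a b c d : Rbar) (u : R -> R -> R),
     nonlinear_solution lambda (rectangle a b c d) u ->
     exists xi V : R -> R -> R,
       hodograph kappa (rectangle a b c d) u xi V /\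
       SKdV_solution mu (hodograph_image kappa (rectangle a b c d) xi) V)
  /\
  (forall (Omega : R -> R -> Prop) (V : R -> R -> R),
     SKdV_solution mu Omega V ->
     forall X0 T0 : R, Omega X0 T0 ->
     exists (a b c d : Rbar) (u xi : R -> R -> R),
       nonlinear_solution lambda (rectangle a b c d) u /\
       hodograph kappa (rectangle a b c d) u xi V /\
       hodograph_image kappa (rectangle a b c d) xi X0 T0 /\
       (forall X T : R,
          hodograph_image kappa (rectangle a b c d) xi X T -> Omega X T)).

(* Main.v *)
Require Import Defs.
From Stdlib Require Import Reals Ranalysis5 Lra Lia ClassicalEpsilon.
From Coquelicot Require Import Coquelicot.
Open Scope R_scope.

(** Put p = 1 / sqrt S[u] and w = lambda p, so that the equation reads
    u_t = w u_x.  Then S[u]_t = w_xxx + 2 w_x S[u] + w S[u]_x, which reduces to the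
    conservation law (1/p)_t = (lambda/2) (p p_xx - p_x^2/2)_x.  Hence the form
    (1/p) dx + (lambda/2) (p p_xx - p_x^2/2) dt is closed; its potential xi is the
    new variable X, and the inverse function V of xi satisfies V_X = p and
    S[V] = p p_xx - p_x^2/2, which gives the evolution of V.

    Conversely, inverting V in X gives xi and p = 1/xi_x with the same
    conservation law, and u with S[u] = 1/p^2 and u_t = w u_x must be found.
    The conservation law says exactly that the Riccati system
    z_x = 1/p^2 + z^2/2, z_t = (w_x + w z)_x for z = u_xx/u_x is compatible.  It is
    solved locally, and then log u_x and u are potentials of closed forms. *)

(** * Smooth functions of two variables *)

(** The factor -lambda/2 comes from differentiating xi(V(X,T), T/kappa) = X in T: V_T = -(1/kappa)
    xi_t/xi_x = -(lambda/(2 kappa)) V_X S[V]. The two constants thus enter only through kappa mu =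
    -lambda/2, and both halves of the final statement are instances of the same pair of theorems.
    Rectangles serve twice. Closed forms on them have potentials, and since their slices are
    intervals, a function with positive x-derivative is injective on each slice, so V is
    single-valued on the whole image. The obstacle is regularity in t. The Riccati equation in x is
    solved on each line t = const separately, which says nothing about how z varies from line to
    line. The t-equation is recovered from the defect z(y,s) - z(y,t) - (s-t) g(y), where g is the
    expected z_t: compatibility makes g a solution of the linearised equation, so the defect obeys a
    linear differential inequality in y with source O((s-t)^2), and its smallness spreads from x =
    x0. Joint smoothness then only requires continuity of z, because both partial derivatives are
    polynomials in z with smooth coefficients. *)

Definition has_partials (D : R -> R -> Prop) (f fx ft : R -> R -> R) : Prop :=
  forall x t, D x t ->
    is_derive (fun y => f y t) x (fx x t) /\ is_derive (fun s => f x s) t (ft x t).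

Definition continuous_2d_on (D : R -> R -> Prop) (f : R -> R -> R) : Prop :=
  forall x t, D x t -> continuity_2d_pt f x t.

Lemma smooth_on_continuous D f : smooth_on D f -> continuous_2d_on D f.
Proof. intros Hf x t Hxt. exact (proj1 (Hf x t Hxt 0%nat)). Qed.

Lemma smooth_on_partials D f : smooth_on D f -> has_partials D f (dx 1 f) (dt f).
Proof.
intros Hf x t Hxt. destruct (Hf x t Hxt 1%nat) as (_ & H1 & H2 & _).
split; [exact (Derive_correct _ _ H1) | exact (Derive_correct _ _ H2)].
Qed.

Lemma smooth_on_dx D f : smooth_on D f -> smooth_on D (dx 1 f).
Proof. intros Hf x t Hxt n. exact (proj1 (proj2 (proj2 (proj2 (Hf x t Hxt (S n)))))). Qed.

Lemma smooth_on_dt D f : smooth_on D f -> smooth_on D (dt f).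
Proof. intros Hf x t Hxt n. exact (proj2 (proj2 (proj2 (proj2 (Hf x t Hxt (S n)))))). Qed.

Lemma smooth_on_dx_n D f n : smooth_on D f -> smooth_on D (dx n f).
Proof.
intros Hf. induction n as [|n IH]; [exact Hf|]. exact (smooth_on_dx D (dx n f) IH).
Qed.

Lemma is_derive_dx D f n x t : smooth_on D f -> D x t ->
  is_derive (fun y => dx n f y t) x (dx (S n) f x t).
Proof. intros Hf. exact (fun H => proj1 (smooth_on_partials D (dx n f) (smooth_on_dx_n D f n
  Hf) x t H)). Qed.

Lemma has_partials_unique D f fx ft x t :
  has_partials D f fx ft -> D x t -> dx 1 f x t = fx x t /\ dt f x t = ft x t.
Proof. intros H Hxt. destruct (H x t Hxt). split; apply is_derive_unique; assumption. Qed.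

Lemma open_slices D x t : open_2d D -> D x t ->
  locally x (fun y => D y t) /\ locally t (fun s => D x s).
Proof.
intros HD Hxt. specialize (HD x t Hxt). split.
- exact (locally_2d_1d_const_y _ _ _ HD).
- exact (locally_2d_1d_const_x _ _ _ HD).
Qed.

(** Continuity of one partial derivative is enough: the increment splits into a horizontal step at
    the perturbed time, controlled by the mean value theorem and continuity of [fx], and a vertical
    step at fixed x, which needs [ft] at the point only. *)
Lemma has_partials_differentiable D f fx ft x t :
  open_2d D -> has_partials D f fx ft -> continuous_2d_on D fx -> D x t ->
  differentiable_pt_lim f x t (fx x t) (ft x t).
Proof.
intros HD Hp Hc Hxt. apply filterdiff_differentiable_pt_lim.
apply (filterdiff_ext_lin _ (fun u : R * R => plus (scal (fst u) (fx x t)) (scal (snd u) (ft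
  x t)))).
2: { intros [u1 u2]. reflexivity. }
apply (is_derive_filterdiff f x t fx (ft x t)).
- apply locally_2d_locally with (P := fun u v => is_derive (fun z => f z v) u (fx u v)).
  apply locally_2d_impl with (2 := HD x t Hxt), locally_2d_forall.
  intros u v Huv. exact (proj1 (Hp u v Huv)).
- exact (proj2 (Hp x t Hxt)).
- apply continuity_2d_pt_filterlim, Hc, Hxt.
Qed.

Lemma differentiable_pt_lim_continuity f x t a b :
  differentiable_pt_lim f x t a b -> continuity_2d_pt f x t.
Proof. intros H. apply differentiable_continuity_pt. now exists a, b. Qed.

Lemma smooth_on_differentiable D f x t : open_2d D -> smooth_on D f -> D x t ->
  differentiable_pt_lim f x t (dx 1 f x t) (dt f x t).
Proof.
intros HD Hf. apply (has_partials_differentiable D); try assumption.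
- now apply smooth_on_partials.
- now apply smooth_on_continuous, smooth_on_dx.
Qed.

Lemma differentiable_pt_lim_partials f x t a b : differentiable_pt_lim f x t a b ->
  is_derive (fun y => f y t) x a /\ is_derive (fun s => f x s) t b.
Proof.
intros H. split; apply is_derive_Reals.
- replace a with (a * 1 + b * 0) by ring.
  apply (derivable_pt_lim_comp_2d f (fun y => y) (fun _ => t)); trivial.
  + apply derivable_pt_lim_id.
  + apply derivable_pt_lim_const.
- replace b with (a * 0 + b * 1) by ring.
  apply (derivable_pt_lim_comp_2d f (fun _ => x) (fun s => s)); trivial.
  + apply derivable_pt_lim_const.
  + apply derivable_pt_lim_id.
Qed.

(* [G] is a set of generators of which nothing but their partial derivatives is
   known. *)
Inductive smooth_closure (G : (R -> R -> R) -> Prop) (D : R -> R -> Prop) :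
    (R -> R -> R) -> Prop :=
| sc_smooth f : smooth_on D f -> smooth_closure G D f
| sc_gen g : G g -> smooth_closure G D g
| sc_plus f g : smooth_closure G D f -> smooth_closure G D g ->
    smooth_closure G D (fun x t => f x t + g x t)
| sc_mult f g : smooth_closure G D f -> smooth_closure G D g ->
    smooth_closure G D (fun x t => f x t * g x t)
| sc_comp E F a b : open_2d E -> smooth_on E F ->
    (forall x t, D x t -> E (a x t) (b x t)) ->
    smooth_closure G D a -> smooth_closure G D b ->
    smooth_closure G D (fun x t => F (a x t) (b x t)).

Lemma continuity_2d_pt_comp F a b x t :
  continuity_2d_pt F (a x t) (b x t) -> continuity_2d_pt a x t ->
  continuity_2d_pt b x t -> continuity_2d_pt (fun u v => F (a u v) (b u v)) x t.
Proof.
intros HF Ha Hb eps. destruct (HF eps) as [d Hd].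
apply locally_2d_impl with (2 := locally_2d_and _ _ _ _ (Ha d) (Hb d)).
apply locally_2d_forall. intros u v [H1 H2]. now apply Hd.
Qed.

(* Bootstrapping: one closed family of functions, each differentiable with
   partial derivatives again in the family, is smooth; this replaces all the
   separate closure properties of C^n. *)
Theorem smooth_closure_smooth G D : open_2d D ->
  (forall g, G g -> continuous_2d_on D g /\
     exists gx gt, smooth_closure G D gx /\ smooth_closure G D gt /\
                   has_partials D g gx gt) ->
  forall f, smooth_closure G D f -> smooth_on D f.
Proof.
intros HD HG.
assert (step : forall f, smooth_closure G D f -> continuous_2d_on D f /\
     exists fx ft, smooth_closure G D fx /\ smooth_closure G D ft /\
                   has_partials D f fx ft).
{ intros f Hf; induction Hf as [f Hf|g Hg|f g Hf [cf (fx & ft & fx_ & ft_ & pf)] Hg [cg (gx &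
    gt & gx_ & gt_ & pg)]
    |f g Hf [cf (fx & ft & fx_ & ft_ & pf)] Hg [cg (gx & gt & gx_ & gt_ & pg)]
    |E F a b HE HF Hm Ha [ca (ax & at_ & ax_ & at__ & pa)] Hb [cb (bx & bt & bx_ & bt_ & pb)]].
  - split; [now apply smooth_on_continuous|].
    exists (dx 1 f), (dt f).
    split; [now apply sc_smooth, smooth_on_dx|].
    split; [now apply sc_smooth, smooth_on_dt|]. now apply smooth_on_partials.
  - now apply HG.
  - split.
    { intros x t Hxt. apply continuity_2d_pt_plus; auto. }
    exists (fun x t => fx x t + gx x t), (fun x t => ft x t + gt x t).
    split; [now apply sc_plus|]. split; [now apply sc_plus|].
    intros x t Hxt. destruct (pf x t Hxt), (pg x t Hxt).
    split; apply @is_derive_plus; assumption.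
  - split.
    { intros x t Hxt. apply continuity_2d_pt_mult; auto. }
    exists (fun x t => fx x t * g x t + f x t * gx x t),
      (fun x t => ft x t * g x t + f x t * gt x t).
    split; [now apply sc_plus; apply sc_mult|]. split; [now apply sc_plus; apply sc_mult|].
    intros x t Hxt. destruct (pf x t Hxt), (pg x t Hxt).
    split.
    + apply (is_derive_mult (fun y => f y t) (fun y => g y t)); trivial. exact Rmult_comm.
    + apply (is_derive_mult (fun s => f x s) (fun s => g x s)); trivial. exact Rmult_comm.
  - split.
    { intros x t Hxt. apply continuity_2d_pt_comp; auto.
      apply (smooth_on_continuous E); auto. }
    exists (fun x t => dx 1 F (a x t) (b x t) * ax x t + dt F (a x t) (b x t) * bx x t),
           (fun x t => dx 1 F (a x t) (b x t) * at_ x t + dt F (a x t) (b x t) * bt x t).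
    assert (smooth_closure G D (fun x t => dx 1 F (a x t) (b x t))).
    { apply (sc_comp G D E); trivial. now apply smooth_on_dx. }
    assert (smooth_closure G D (fun x t => dt F (a x t) (b x t))).
    { apply (sc_comp G D E); trivial. now apply smooth_on_dt. }
    split; [now apply sc_plus; apply sc_mult|]. split; [now apply sc_plus; apply sc_mult|].
    intros x t Hxt. destruct (pa x t Hxt), (pb x t Hxt).
    (* The chain rule needs total differentiability of the outer function; for the inner ones,
       derivatives along the slice suffice. *)
    assert (HdF := smooth_on_differentiable E F _ _ HE HF (Hm x t Hxt)).
    split; apply is_derive_Reals.
    + apply (derivable_pt_lim_comp_2d F (fun y => a y t) (fun y => b y t)); trivial;
      apply is_derive_Reals; assumption.
    + apply (derivable_pt_lim_comp_2d F (fun s => a x s) (fun s => b x s)); trivial;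
      apply is_derive_Reals; assumption. }
(* The induction on the order runs over all members of the family at once, since the partial
   derivatives of one member are other members. *)
intros f Hf x t Hxt n. revert f Hf x t Hxt.
induction n as [|n IH]; intros f Hf x t Hxt;
  destruct (step f Hf) as [cf (fx & ft & fx_ & ft_ & pf)].
{ split; auto. }
split; [auto|]. destruct (pf x t Hxt) as [p1 p2].
split; [eexists; exact p1|]. split; [eexists; exact p2|]. split.
- apply ex_diff_n_ext_loc with fx; [|now apply IH].
  apply locally_2d_impl with (2 := HD x t Hxt), locally_2d_forall.
  intros u v Huv. symmetry. apply is_derive_unique, (pf u v Huv).
- apply ex_diff_n_ext_loc with ft; [|now apply IH].
  apply locally_2d_impl with (2 := HD x t Hxt), locally_2d_forall.
  intros u v Huv. symmetry. apply is_derive_unique, (pf u v Huv).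
Qed.

(** * Closure properties of smooth functions *)

Definition no_generator (f : R -> R -> R) : Prop := False.

Lemma smooth_closure_nil D f :
  open_2d D -> smooth_closure no_generator D f -> smooth_on D f.
Proof. intros HD. apply smooth_closure_smooth; trivial. now intros g []. Qed.

Lemma smooth_on_ext D f g : open_2d D -> (forall x t, D x t -> f x t = g x t) ->
  smooth_on D f -> smooth_on D g.
Proof.
intros HD Hfg Hf x t Hxt n. apply ex_diff_n_ext_loc with f; [|now apply Hf].
apply locally_2d_impl with (2 := HD x t Hxt), locally_2d_forall. exact Hfg.
Qed.

Lemma smooth_on_subset (D E : R -> R -> Prop) f :
  (forall x t, D x t -> E x t) -> smooth_on E f -> smooth_on D f.
Proof. intros H Hf x t Hxt. now apply Hf, H. Qed.

Lemma smooth_on_const D c : smooth_on D (fun _ _ => c).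
Proof.
assert (H : forall n c x t, ex_diff_n (fun _ _ => c) n x t).
{ clear. induction n as [|n IH]; intros c x t; (split; [apply continuity_2d_pt_const|]);
    trivial.
  split; [apply ex_derive_const|]. split; [apply ex_derive_const|].
  split; apply ex_diff_n_ext_loc with (fun _ _ => 0); trivial;
  apply locally_2d_forall; intros u v; now rewrite Derive_const. }
intros x t _ n. apply H.
Qed.

Lemma smooth_on_plus D f g : open_2d D -> smooth_on D f -> smooth_on D g ->
  smooth_on D (fun x t => f x t + g x t).
Proof. intros. apply smooth_closure_nil; trivial. now apply sc_plus; apply sc_smooth. Qed.

Lemma smooth_on_mult D f g : open_2d D -> smooth_on D f -> smooth_on D g ->
  smooth_on D (fun x t => f x t * g x t).
Proof. intros. apply smooth_closure_nil; trivial. now apply sc_mult; apply sc_smooth. Qed.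

Lemma smooth_on_scal D c f : open_2d D -> smooth_on D f -> smooth_on D (fun x t => c * f x t).
Proof. intros. apply smooth_on_mult; trivial. apply smooth_on_const. Qed.

Lemma smooth_on_minus D f g : open_2d D -> smooth_on D f -> smooth_on D g ->
  smooth_on D (fun x t => f x t - g x t).
Proof.
intros HD Hf Hg. apply smooth_on_ext with (fun x t => f x t + (-1) * g x t); trivial.
{ intros; ring. }
apply smooth_on_plus; trivial. now apply smooth_on_scal.
Qed.

Lemma smooth_on_comp D E F a b : open_2d D -> open_2d E -> smooth_on E F ->
  (forall x t, D x t -> E (a x t) (b x t)) -> smooth_on D a -> smooth_on D b ->
  smooth_on D (fun x t => F (a x t) (b x t)).
Proof.
intros. apply smooth_closure_nil; trivial.
now apply (sc_comp _ _ E); trivial; apply sc_smooth.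
Qed.

Lemma smooth_on_fst D : open_2d D -> smooth_on D (fun x _ => x).
Proof.
intros HD. apply smooth_closure_smooth with (fun f => f = (fun x _ => x)); trivial.
2: now apply sc_gen.
intros g ->. split. { intros x t _. apply continuity_2d_pt_id1. }
exists (fun _ _ => 1), (fun _ _ => 0).
split; [apply sc_smooth, smooth_on_const|]. split; [apply sc_smooth, smooth_on_const|].
intros x t _. split; auto_derive; trivial.
Qed.

Lemma smooth_on_snd D : open_2d D -> smooth_on D (fun _ t => t).
Proof.
intros HD. apply smooth_closure_smooth with (fun f => f = (fun _ t => t)); trivial.
2: now apply sc_gen.
intros g ->. split. { intros x t _. apply continuity_2d_pt_id2. }
exists (fun _ _ => 0), (fun _ _ => 1).
split; [apply sc_smooth, smooth_on_const|]. split; [apply sc_smooth, smooth_on_const|].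
intros x t _. split; auto_derive; trivial.
Qed.

Lemma open_2d_full : open_2d (fun _ _ => True).
Proof. intros x t _. now apply locally_2d_forall. Qed.

Lemma open_2d_preimage (D E : R -> R -> Prop) a b : open_2d D -> open_2d E ->
  continuous_2d_on D a -> continuous_2d_on D b ->
  open_2d (fun x t => D x t /\ E (a x t) (b x t)).
Proof.
intros HD HE Ha Hb x t [HDxt HExt].
apply locally_2d_and; [now apply HD|].
destruct (HE _ _ HExt) as [d Hd].
apply locally_2d_impl with (2 := locally_2d_and _ _ _ _ (Ha x t HDxt d) (Hb x t HDxt d)).
apply locally_2d_forall. intros u v [H1 H2]. now apply Hd.
Qed.

Lemma open_2d_pos : open_2d (fun x _ => 0 < x).
Proof.
intros x t Hx. exists (mkposreal x Hx). intros u v Hu _. simpl in Hu.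
apply Rabs_def2 in Hu. lra.
Qed.

Lemma open_2d_neq0 : open_2d (fun x _ => x <> 0).
Proof.
intros x t Hx. exists (mkposreal _ (Rabs_pos_lt _ Hx)). intros u v Hu _ ->. simpl in Hu.
rewrite Rminus_0_l, Rabs_Ropp in Hu. lra.
Qed.

(** One-variable functions are lifted to ignore their second argument, so that composition covers
    them. Here a single generator suffices, because (1/x)' = -(1/x)^2 is a polynomial in 1/x. *)
Lemma smooth_on_inv_fst : smooth_on (fun x _ => x <> 0) (fun x _ => / x).
Proof.
apply smooth_closure_smooth with (fun f => f = (fun x _ => / x)); trivial using open_2d_neq0.
2: now apply sc_gen.
intros g ->. split.
{ intros x t Hx. apply continuity_2d_pt_inv; trivial. apply continuity_2d_pt_id1. }
exists (fun x _ => (-1) * (/ x * / x)), (fun _ _ => 0).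
split. { apply (sc_mult _ _ (fun _ _ => -1)); [apply sc_smooth, smooth_on_const|].
  apply (sc_mult _ _ (fun x _ => / x) (fun x _ => / x)); now apply sc_gen. }
split; [apply sc_smooth, smooth_on_const|].
intros x t Hx. split; auto_derive; trivial. now field.
Qed.

Lemma smooth_on_exp_fst : smooth_on (fun _ _ => True) (fun x _ => exp x).
Proof.
apply smooth_closure_smooth with (fun f => f = (fun x _ => exp x)); trivial using open_2d_full.
2: now apply sc_gen.
intros g ->. split.
{ intros x t Hx. apply (continuity_1d_2d_pt_comp exp (fun x _ => x)).
  - apply derivable_continuous_pt, derivable_pt_exp.
  - apply continuity_2d_pt_id1. }
exists (fun x _ => exp x), (fun _ _ => 0).
split; [now apply sc_gen|].
split; [apply sc_smooth, smooth_on_const|].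
intros x t Hx. split; auto_derive; trivial. ring.
Qed.

Lemma smooth_on_inv D f : open_2d D -> smooth_on D f ->
  (forall x t, D x t -> f x t <> 0) -> smooth_on D (fun x t => / f x t).
Proof.
intros HD Hf H0. apply (smooth_on_comp D (fun x _ => x <> 0) (fun x _ => / x) f f);
  trivial using open_2d_neq0, smooth_on_inv_fst.
Qed.

Lemma smooth_on_div D f g : open_2d D -> smooth_on D f -> smooth_on D g ->
  (forall x t, D x t -> g x t <> 0) -> smooth_on D (fun x t => f x t / g x t).
Proof. intros. apply smooth_on_mult; trivial. now apply smooth_on_inv. Qed.

Lemma smooth_on_exp D f : open_2d D -> smooth_on D f -> smooth_on D (fun x t => exp (f x t)).
Proof.
intros HD Hf. apply (smooth_on_comp D (fun _ _ => True) (fun x _ => exp x) f f);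
  trivial using open_2d_full, smooth_on_exp_fst.
Qed.

(** The square root alone does not generate its derivatives, but together with s = 1/sqrt x it does:
    (sqrt x)' = s/2 and s' = -s^3/2. *)
Lemma smooth_on_sqrt_fst : smooth_on (fun x _ => 0 < x) (fun x _ => sqrt x).
Proof.
apply smooth_closure_smooth with (fun f => f = (fun x _ => sqrt x) \/ f = (fun x _ => / sqrt
  x));
  trivial using open_2d_pos.
2: now apply sc_gen; left.
assert (C : continuous_2d_on (fun x _ => 0 < x) (fun x _ => sqrt x)).
{ intros x t Hx. apply (continuity_1d_2d_pt_comp sqrt (fun x _ => x)).
  - apply continuity_pt_sqrt; lra.
  - apply continuity_2d_pt_id1. }
assert (N : forall x, 0 < x -> sqrt x <> 0).
{ intros x Hx. apply Rgt_not_eq. now apply sqrt_lt_R0. }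
assert (K : smooth_closure (fun f => f = (fun x _ => sqrt x) \/ f = (fun x _ => / sqrt x))
  (fun x _ => 0 < x) (fun x _ => / sqrt x)) by (now apply sc_gen; right).
intros g [->| ->]; (split; [trivial|]).
- exists (fun x _ => / 2 * / sqrt x), (fun _ _ => 0).
  split. { apply (sc_mult _ _ (fun _ _ => /2)); [apply sc_smooth, smooth_on_const|trivial]. }
  split; [apply sc_smooth, smooth_on_const|].
  intros x t Hx. split; auto_derive; trivial. specialize (N x Hx). now field.
- intros x t Hx. apply continuity_2d_pt_inv; auto.
- exists (fun x _ => - / 2 * (/ sqrt x * (/ sqrt x * / sqrt x))), (fun _ _ => 0).
  split. { apply (sc_mult _ _ (fun _ _ => - /2)); [apply sc_smooth, smooth_on_const|trivial].
    apply (sc_mult _ _ (fun x _ => / sqrt x) (fun x _ => / sqrt x * / sqrt x)); trivial.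
    now apply (sc_mult _ _ (fun x _ => / sqrt x) (fun x _ => / sqrt x)). }
  split; [apply sc_smooth, smooth_on_const|].
  intros x t Hx. split; auto_derive; trivial; auto. specialize (N x Hx). now field.
Qed.

Lemma smooth_on_sqrt D f : open_2d D -> smooth_on D f ->
  (forall x t, D x t -> 0 < f x t) -> smooth_on D (fun x t => sqrt (f x t)).
Proof.
intros HD Hf H0. apply (smooth_on_comp D (fun x _ => 0 < x) (fun x _ => sqrt x) f f);
  trivial using open_2d_pos, smooth_on_sqrt_fst.
Qed.

(** * Potentials and inverse functions on rectangles *)

Lemma open_2d_rectangle a b c d : open_2d (rectangle a b c d).
Proof.
intros x t (H1 & H2 & H3 & H4).
assert (Hx : locally x (fun y => Rbar_lt a y /\ Rbar_lt y b)).
{ apply filter_and; [now apply open_Rbar_gt|now apply open_Rbar_lt]. }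
assert (Ht : locally t (fun y => Rbar_lt c y /\ Rbar_lt y d)).
{ apply filter_and; [now apply open_Rbar_gt|now apply open_Rbar_lt]. }
destruct Hx as [e1 He1], Ht as [e2 He2].
exists (mkposreal _ (Rmin_stable_in_posreal e1 e2)). simpl. intros u v Hu Hv.
assert (B1 : ball x e1 u) by (apply Rlt_le_trans with (1 := Hu), Rmin_l).
assert (B2 : ball t e2 v) by (apply Rlt_le_trans with (1 := Hv), Rmin_r).
destruct (He1 u B1), (He2 v B2). now repeat split.
Qed.

Lemma rectangle_convex_x a b c d x1 x2 y t : rectangle a b c d x1 t ->
  rectangle a b c d x2 t -> Rmin x1 x2 <= y <= Rmax x1 x2 -> rectangle a b c d y t.
Proof.
intros (A1 & B1 & C & D) (A2 & B2 & _ & _) [L U]. repeat split; trivial.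
- apply Rbar_lt_le_trans with (Rmin x1 x2); [|exact L]. now apply Rmin_case.
- apply Rbar_le_lt_trans with (Rmax x1 x2); [exact U|]. now apply Rmax_case.
Qed.

Lemma rectangle_convex_t a b c d x t1 t2 s : rectangle a b c d x t1 ->
  rectangle a b c d x t2 -> Rmin t1 t2 <= s <= Rmax t1 t2 -> rectangle a b c d x s.
Proof.
intros (A & B & C1 & D1) (_ & _ & C2 & D2) [L U]. repeat split; trivial.
- apply Rbar_lt_le_trans with (Rmin t1 t2); [|exact L]. now apply Rmin_case.
- apply Rbar_le_lt_trans with (Rmax t1 t2); [exact U|]. now apply Rmax_case.
Qed.

Lemma rectangle_corner a b c d x1 t1 x2 t2 : rectangle a b c d x1 t1 ->
  rectangle a b c d x2 t2 -> rectangle a b c d x1 t2.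
Proof. now intros (A & B & _ & _) (_ & _ & C & D). Qed.

Lemma continuity_2d_pt_slices f x t : continuity_2d_pt f x t ->
  continuous (fun y => f y t) x /\ continuous (fun s => f x s) t.
Proof.
intros H. split; apply continuity_pt_filterlim; intros eps Heps;
destruct (H (mkposreal eps Heps)) as [d Hd]; exists d;
(split; [apply cond_pos|]); intros u [_ Hu]; apply Hd; trivial;
rewrite Rminus_eq_0, Rabs_R0; apply cond_pos.
Qed.

Lemma continuity_2d_pt_swap f x t : continuity_2d_pt f x t ->
  continuity_2d_pt (fun u v => f v u) t x.
Proof.
intros H eps. destruct (H eps) as [d Hd]. exists d. intros u v Hu Hv. now apply Hd.
Qed.

(** The potential integrates f dx + g dt from (x0,t0) vertically to (x0,t) and then horizontally to
    (x,t). Its x-derivative is immediate. For the t-derivative, differentiation under the integral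
    and f_t = g_x turn the horizontal part into g(x,t) - g(x0,t), and the vertical part supplies the
    missing g(x0,t). *)
Lemma closed_form_potential a b c d x0 t0 f g : rectangle a b c d x0 t0 ->
  smooth_on (rectangle a b c d) f -> smooth_on (rectangle a b c d) g ->
  (forall x t, rectangle a b c d x t -> dt f x t = dx 1 g x t) ->
  exists xi, smooth_on (rectangle a b c d) xi /\ has_partials (rectangle a b c d) xi f g.
Proof.
intros H0 Hf Hg Hfg. set (D := rectangle a b c d) in *.
assert (HD : open_2d D) by apply open_2d_rectangle.
assert (cf := smooth_on_continuous D f Hf).
assert (cg := smooth_on_continuous D g Hg).
assert (cft := smooth_on_continuous D _ (smooth_on_dt D f Hf)).
assert (pf := smooth_on_partials D f Hf).
assert (pg := smooth_on_partials D g Hg).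
assert (If : forall x t, D x t -> ex_RInt (fun y => f y t) x0 x).
{ intros x t Hxt. apply (@ex_RInt_continuous R_CompleteNormedModule). intros y Hy.
  apply (continuity_2d_pt_slices f y t), cf.
  apply (rectangle_convex_x a b c d x0 x); trivial.
  exact (rectangle_corner _ _ _ _ _ _ _ _ H0 Hxt). }
pose (xi := fun x t => RInt (fun y => f y t) x0 x + RInt (fun s => g x0 s) t0 t).
assert (P : has_partials D xi f g).
{ intros x t Hxt.
  assert (H0t : D x0 t) by exact (rectangle_corner _ _ _ _ _ _ _ _ H0 Hxt).
  destruct (open_slices D x t HD Hxt) as [Lx Lt].
  destruct (open_slices D x0 t HD H0t) as [_ L0t].
  assert (Sl : forall y, Rmin x0 x <= y <= Rmax x0 x -> D y t).
  { intros y Hy. now apply (rectangle_convex_x a b c d x0 x). }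
  split; unfold xi.
  - replace (f x t) with (f x t + 0) by ring.
    apply (is_derive_plus (fun x => RInt (fun y => f y t) x0 x) (fun x => RInt (fun s => g x0
      s) t0 t)).
    2: apply (is_derive_const (RInt (fun s : R => g x0 s) t0 t)).
    apply (is_derive_RInt (fun y => f y t) _ x0).
    + revert Lx. apply filter_imp. intros y Hy.
      now apply (@RInt_correct R_CompleteNormedModule), If.
    + now apply (continuity_2d_pt_slices f x t), cf.
  - replace (g x t) with (RInt (fun y => Derive (fun s => f y s) t) x0 x + g x0 t).
    apply (is_derive_plus (fun t => RInt (fun y => f y t) x0 x) (fun t => RInt (fun s => g x0
      s) t0 t)).
    + apply (is_derive_RInt_param (fun s y => f y s)).
      * generalize (filter_and _ _ Lt L0t).
        apply filter_imp. intros s [Hs Hs0] y Hy. eexists. apply (pf y s).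
        now apply (rectangle_convex_x a b c d x0 x).
      * intros y Hy. apply (continuity_2d_pt_swap (dt f)), cft, Sl, Hy.
      * revert Lt. apply filter_imp. intros s Hs. now apply If.
    + apply (is_derive_RInt (fun s => g x0 s) _ t0).
      * revert L0t. apply filter_imp. intros s Hs.
        apply (@RInt_correct R_CompleteNormedModule),
          (@ex_RInt_continuous R_CompleteNormedModule).
        intros s' Hs'. apply (continuity_2d_pt_slices g x0 s'), cg.
        now apply (rectangle_convex_t a b c d x0 t0 s).
      * now apply (continuity_2d_pt_slices g x0 t), cg.
    + rewrite (RInt_ext _ (fun y => dx 1 g y t)).
      2: { intros y Hy. apply Hfg, Sl. lra. }
      rewrite (is_RInt_unique _ _ _ (g x t - g x0 t)).
      { ring. }
      apply (is_RInt_derive (fun y => g y t)).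
      * intros y Hy. now apply pg, Sl.
      * intros y Hy. apply (continuity_2d_pt_slices (dx 1 g) y t).
        apply (smooth_on_continuous D); [now apply smooth_on_dx|now apply Sl]. }
exists xi. split; trivial.
apply smooth_closure_smooth with (fun h => h = xi); trivial. 2: now apply sc_gen.
intros h ->. split.
- intros x t Hxt. apply differentiable_pt_lim_continuity with (f x t) (g x t).
  now apply (has_partials_differentiable D).
- exists f, g. split; [now apply sc_smooth|]. split; [now apply sc_smooth|trivial].
Qed.

Lemma Rabs_sub3 x y z : Rabs (x - y - z) <= Rabs x + Rabs y + Rabs z.
Proof.
assert (H1 := Rabs_triang (x - y) (- z)). assert (H2 := Rabs_triang x (- y)).
rewrite Rabs_Ropp in H1, H2. unfold Rminus in *. lra.
Qed.

(** * Inversion in the space variable, with time as a parameter *)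

Section Inverse.

Variables (a b c d : Rbar) (G : R -> R -> R).
Local Notation E := (rectangle a b c d).
Hypothesis smooth_G : smooth_on E G.
Hypothesis dG_pos : forall y s, E y s -> 0 < dx 1 G y s.

Lemma slice_increasing y1 y2 s : E y1 s -> E y2 s -> y1 < y2 -> G y1 s < G y2 s.
Proof.
intros (A1 & B1 & C & D) (A2 & B2 & _ & _) Hy.
apply (incr_function (fun y => G y s) a b (fun y => dx 1 G y s)); trivial.
- intros y Ha Hb. now apply (smooth_on_partials E G smooth_G).
- intros y Ha Hb. now apply dG_pos.
Qed.

Lemma slice_injective y1 y2 s : E y1 s -> E y2 s -> G y1 s = G y2 s -> y1 = y2.
Proof.
intros H1 H2 H. destruct (Rtotal_order y1 y2) as [L|[->|L]]; trivial.
- assert (K := slice_increasing _ _ _ H1 H2 L). lra.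
- assert (K := slice_increasing _ _ _ H2 H1 L). lra.
Qed.

(** Monotonicity puts G(y0,s0) strictly between the values at y0 - e and y0 + e. By continuity at
    these two end points this persists for nearby times and targets, and the intermediate value
    theorem gives a preimage. Both openness of the image and continuity of the inverse follow. *)
Lemma slice_locally_onto y0 s0 (eps : posreal) : E y0 s0 ->
  locally_2d (fun x s => exists y, Rabs (y - y0) < eps /\ E y s /\ G y s = x) (G y0 s0) s0.
Proof.
intros H0. destruct (open_2d_rectangle a b c d y0 s0 H0) as [e0 He0].
assert (cG := smooth_on_continuous E G smooth_G).
assert (Pe := cond_pos eps). assert (Pe0 := cond_pos e0).
pose (e := Rmin eps e0 / 2).
assert (0 < e < eps /\ e < e0) as [[He1 He2] He3].
{ unfold e. assert (Q := Rmin_stable_in_posreal eps e0).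
  assert (Q1 := Rmin_l eps e0). assert (Q2 := Rmin_r eps e0). lra. }
assert (Hbox : forall y s, Rabs (y - y0) <= e -> Rabs (s - s0) < e0 -> E y s).
{ intros y s Hy Hs. apply He0; lra. }
assert (Z0 : Rabs (s0 - s0) < e0) by (rewrite Rminus_eq_0, Rabs_R0; lra).
assert (Bl : Rabs (y0 - e - y0) <= e) by (apply Rabs_le; lra).
assert (Br : Rabs (y0 + e - y0) <= e) by (apply Rabs_le; lra).
assert (Hl := slice_increasing (y0 - e) y0 s0 (Hbox _ _ Bl Z0) H0 ltac:(lra)).
assert (Hr := slice_increasing y0 (y0 + e) s0 H0 (Hbox _ _ Br Z0) ltac:(lra)).
(* Half of each gap absorbs the change of time, the other half the displacement of the target. *)
assert (ml : 0 < (G y0 s0 - G (y0 - e) s0) / 2) by lra.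
assert (mr : 0 < (G (y0 + e) s0 - G y0 s0) / 2) by lra.
destruct (cG _ _ (Hbox _ _ Bl Z0) (mkposreal _ ml)) as [d1 Hd1]. simpl in Hd1.
destruct (cG _ _ (Hbox _ _ Br Z0) (mkposreal _ mr)) as [d2 Hd2]. simpl in Hd2.
pose (d1' := mkposreal _ (Rmin_stable_in_posreal d1 d2)).
pose (d2' := mkposreal _ (Rmin_stable_in_posreal (mkposreal _ ml) (mkposreal _ mr))).
pose (d3' := mkposreal _ (Rmin_stable_in_posreal d1' d2')).
exists (mkposreal _ (Rmin_stable_in_posreal e0 d3')). simpl.
intros x s Hx Hs.
apply Rmin_Rgt in Hx as [Hx0 Hx]. apply Rmin_Rgt in Hx as [_ Hx].
apply Rmin_Rgt in Hx as [Hx1 Hx2].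
apply Rmin_Rgt in Hs as [Hs0 Hs]. apply Rmin_Rgt in Hs as [Hs _].
apply Rmin_Rgt in Hs as [Hs1 Hs2].
assert (T1 := Hd1 (y0 - e) s ltac:(rewrite Rminus_eq_0, Rabs_R0; apply cond_pos) Hs1).
assert (T2 := Hd2 (y0 + e) s ltac:(rewrite Rminus_eq_0, Rabs_R0; apply cond_pos) Hs2).
apply Rabs_def2 in T1. apply Rabs_def2 in T2. apply Rabs_def2 in Hx1. apply Rabs_def2 in Hx2.
destruct (IVT_interv (fun y => G y s - x) (y0 - e) (y0 + e)) as [y [Hy Hyx]].
- intros y Hy. apply continuity_pt_minus; [|apply continuity_pt_const; now intros ? ?].
  apply continuity_pt_filterlim. apply (continuity_2d_pt_slices G y s), cG, Hbox; trivial.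
  apply Rabs_le. lra.
- lra.
- lra.
- lra.
- exists y. assert (Rabs (y - y0) <= e) by (apply Rabs_le; lra).
  split; [lra|]. split; [now apply Hbox|lra].
Qed.

Definition slice_image (x s : R) : Prop := exists y, E y s /\ x = G y s.

Lemma open_2d_slice_image : open_2d slice_image.
Proof.
intros x s (y & Hy & ->).
apply locally_2d_impl with (2 := slice_locally_onto y s (mkposreal 1 Rlt_0_1) Hy),
  locally_2d_forall.
intros u v (y' & _ & H1 & H2). now exists y'.
Qed.

(** Choice makes the inverse a total function, as the encoding of functions demands; off
    [slice_image] its values are arbitrary. *)
Definition slice_inverse (x s : R) : R := epsilon (inhabits 0) (fun y => E y s /\ G y s = x).

Lemma slice_inverse_spec x s : slice_image x s ->
  E (slice_inverse x s) s /\ G (slice_inverse x s) s = x.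
Proof.
intros (y & Hy & ->).
exact (epsilon_spec (inhabits 0) (fun y' => E y' s /\ G y' s = G y s) (ex_intro _ y (conj Hy
  eq_refl))).
Qed.

Lemma slice_inverseK y s : E y s -> slice_inverse (G y s) s = y.
Proof.
intros Hy. destruct (slice_inverse_spec (G y s) s) as [H1 H2]; [now exists y|].
now apply (slice_injective _ _ s).
Qed.

Lemma slice_inverse_continuous : continuous_2d_on slice_image slice_inverse.
Proof.
intros x s (y & Hy & ->) eps. rewrite (slice_inverseK y s Hy).
apply locally_2d_impl with (2 := slice_locally_onto y s eps Hy), locally_2d_forall.
intros u v (y' & H1 & H2 & <-). now rewrite slice_inverseK.
Qed.

(** The linearisation of G at (y,s) reads u - x = p w + r (v - s) + error, with w the increment of
    the inverse. The error bound itself contains |w|; once its coefficient is at most p/2 it can be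
    absorbed, so w is O(m), with m the size of the displacement of (x,s), and the error is small
    relative to m. *)
Lemma slice_inverse_differentiable x s : slice_image x s ->
  differentiable_pt_lim slice_inverse x s (/ dx 1 G (slice_inverse x s) s)
    (- dt G (slice_inverse x s) s / dx 1 G (slice_inverse x s) s).
Proof.
intros Hxs. destruct (slice_inverse_spec x s Hxs) as [Hy HG].
set (y := slice_inverse x s) in *. set (p := dx 1 G y s). set (r := dt G y s).
assert (Hp : 0 < p) by (now apply dG_pos).
intros eps. assert (Peps := cond_pos eps).
(* [K] will satisfy |w| + m <= K m. The tolerance [e] below is at most p/2 for the absorption, and
   at most eps p / K so that the error divided by p is at most eps m. *)
pose (K := 1 + 2 * (1 + Rabs r + p) / p).
assert (HK : 1 <= K).
{ unfold K. assert (0 <= 2 * (1 + Rabs r + p) / p); [|lra].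
  apply Rmult_le_pos; [assert (A := Rabs_pos r); lra|]. left. now apply Rinv_0_lt_compat. }
assert (He : 0 < Rmin (p / 2) (eps * p / K)).
{ apply Rmin_pos; [lra|]. apply Rdiv_lt_0_compat; [|lra]. now apply Rmult_lt_0_compat. }
set (e := Rmin (p / 2) (eps * p / K)) in *.
assert (He1 : e <= p / 2) by apply Rmin_l.
assert (He2 : e * K <= eps * p).
{ apply Rle_trans with (eps * p / K * K); [|right; field; lra].
  apply Rmult_le_compat_r; [lra|apply Rmin_r]. }
destruct (smooth_on_differentiable E G y s (open_2d_rectangle a b c d) smooth_G Hy (mkposreal
  e He))
  as [d1 Hd1]. simpl in Hd1.
assert (Hc := slice_inverse_continuous x s Hxs d1).
assert (Hd : locally_2d (fun _ v => Rabs (v - s) < d1) x s) by (exists d1; auto).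
apply locally_2d_impl with (2 := locally_2d_and _ _ _ _ (open_2d_slice_image x s Hxs)
  (locally_2d_and _ _ _ _ Hc Hd)).
apply locally_2d_forall. intros u v (Huv & H1 & H2). fold y in H1 |- *.
destruct (slice_inverse_spec u v Huv) as [_ HGu].
specialize (Hd1 _ _ H1 H2). rewrite HGu, HG in Hd1. fold p r in Hd1.
set (w := slice_inverse u v - y) in *.
set (m := Rmax (Rabs (u - x)) (Rabs (v - s))).
assert (M1 : Rabs (u - x) <= m) by apply Rmax_l.
assert (M2 : Rabs (v - s) <= m) by apply Rmax_r.
assert (M0 := Rabs_pos (u - x)).
assert (Hmax : Rmax (Rabs w) (Rabs (v - s)) <= Rabs w + m).
{ assert (W := Rabs_pos w). apply Rmax_lub; lra. }
assert (Q : Rabs (u - x - (p * w + r * (v - s))) <= e * (Rabs w + m)).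
{ apply Rle_trans with (1 := Hd1). apply Rmult_le_compat_l; lra. }
assert (Hw : p * Rabs w <= m + Rabs r * m + e * (Rabs w + m)).
{ replace (p * Rabs w) with (Rabs (p * w)) by (rewrite Rabs_mult, (Rabs_pos_eq p); lra).
  replace (p * w) with ((u - x) - r * (v - s) - (u - x - (p * w + r * (v - s)))) by ring.
  assert (T := Rabs_sub3 (u - x) (r * (v - s)) (u - x - (p * w + r * (v - s)))).
  rewrite (Rabs_mult r) in T.
  assert (Rabs r * Rabs (v - s) <= Rabs r * m) by (apply Rmult_le_compat_l;
    [apply Rabs_pos|lra]).
  lra. }
assert (Hw2 : Rabs w + m <= K * m).
{ assert (e * (Rabs w + m) <= p / 2 * (Rabs w + m)).
  { apply Rmult_le_compat_r; [|lra]. assert (W := Rabs_pos w). lra. }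
  assert (p * Rabs w <= 2 * (1 + Rabs r + p) * m) by nra.
  assert (Rabs w <= 2 * (1 + Rabs r + p) * m / p).
  { apply Rmult_le_reg_l with p; trivial. field_simplify; [|lra]. lra. }
  unfold K. replace ((1 + 2 * (1 + Rabs r + p) / p) * m) with (m + 2 * (1 + Rabs r + p) * m /
    p) by (field; lra).
  lra. }
replace (w - (/ p * (u - x) + - r / p * (v - s)))
  with (- (u - x - (p * w + r * (v - s))) / p) by (field; lra).
unfold Rdiv. rewrite Rabs_mult, Rabs_Ropp, (Rabs_pos_eq (/ p)) by (left;
  now apply Rinv_0_lt_compat).
apply Rmult_le_reg_r with p; trivial. rewrite Rmult_assoc, Rinv_l, Rmult_1_r by lra.
assert (0 <= m) by lra. assert (e * (Rabs w + m) <= e * (K * m)) by (apply Rmult_le_compat_l;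
  lra).
assert (e * K * m <= eps * p * m) by (apply Rmult_le_compat_r; lra).
lra.
Qed.

Lemma slice_inverse_partials : has_partials slice_image slice_inverse
  (fun x s => / dx 1 G (slice_inverse x s) s)
  (fun x s => - dt G (slice_inverse x s) s / dx 1 G (slice_inverse x s) s).
Proof.
intros x s Hxs. now apply differentiable_pt_lim_partials, slice_inverse_differentiable.
Qed.

(** The partial derivatives of the inverse are smooth functions of G's variables evaluated at
    (inverse, s), so the inverse is a generator whose derivatives lie in its own closure. *)
Lemma slice_inverse_smooth : smooth_on slice_image slice_inverse.
Proof.
apply smooth_closure_smooth with (fun h => h = slice_inverse).
- exact open_2d_slice_image.
- intros h ->. split; [exact slice_inverse_continuous|].
  assert (oE : open_2d E) by apply open_2d_rectangle.
  assert (N : forall y s, E y s -> dx 1 G y s <> 0).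
  { intros y s H. now apply Rgt_not_eq, dG_pos. }
  assert (K : forall F, smooth_on E F -> smooth_closure (fun h => h = slice_inverse) slice_image
    (fun x s => F (slice_inverse x s) s)).
  { intros F HF. apply (sc_comp _ _ E F slice_inverse (fun _ s => s)); trivial.
    - intros x s H. now apply slice_inverse_spec.
    - now apply sc_gen.
    - apply sc_smooth, smooth_on_snd, open_2d_slice_image. }
  eexists _, _. split; [|split; [|exact slice_inverse_partials]].
  + apply (K (fun y s => / dx 1 G y s)). apply smooth_on_inv; trivial. now apply smooth_on_dx.
  + apply (K (fun y s => - dt G y s / dx 1 G y s)). apply smooth_on_div; trivial.
    * apply smooth_on_ext with (fun y s => -1 * dt G y s); trivial.
      { intros; ring. }
      apply smooth_on_scal; trivial. now apply smooth_on_dt.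
    * now apply smooth_on_dx.
- now apply sc_gen.
Qed.

End Inverse.

(** * Ordinary differential equations *)

(** The 1-Lipschitz retraction of the line onto [c - r, c + r]. Precomposition with it extends a
    right-hand side from a box to the plane with the same bounds, so that Picard iterates and their
    integrals exist everywhere. *)
Definition clamp (c r x : R) : R := Rmax (c - r) (Rmin (c + r) x).

Lemma clamp_bound c r x : 0 <= r -> Rabs (clamp c r x - c) <= r.
Proof.
intros Hr. unfold clamp. apply Rabs_le. apply Rmin_case_strong; intros;
  apply Rmax_case_strong; lra.
Qed.

Lemma clamp_id c r x : Rabs (x - c) <= r -> clamp c r x = x.
Proof.
intros H. apply Rabs_le_between in H. unfold clamp. rewrite Rmin_right, Rmax_right; lra.
Qed.

Lemma clamp_lipschitz c r x y : Rabs (clamp c r x - clamp c r y) <= Rabs (x - y).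
Proof.
unfold clamp.
repeat (apply Rmin_case_strong; intros); repeat (apply Rmax_case_strong; intros);
unfold Rabs; repeat destruct Rcase_abs; lra.
Qed.

Lemma clamp_continuous c r x : continuity_pt (clamp c r) x.
Proof.
intros e He. exists e. split; trivial. intros y [_ Hy].
apply Rle_lt_trans with (2 := Hy). apply clamp_lipschitz.
Qed.

Lemma continuous_2d_slice F y : (forall x v, continuity_2d_pt F x v) ->
  (forall x, continuous y x) -> forall x, continuous (fun s => F s (y s)) x.
Proof.
intros HF Hy x.
assert (H : continuity_2d_pt (fun u _ => F u (y u)) x 0).
{ apply (continuity_2d_pt_comp F (fun u _ => u) (fun u _ => y u)); trivial.
  - apply continuity_2d_pt_id1.
  - apply (continuity_1d_2d_pt_comp y (fun u _ => u)).
    + apply continuity_pt_filterlim, Hy.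
    + apply continuity_2d_pt_id1. }
exact (proj1 (continuity_2d_pt_slices _ _ _ H)).
Qed.

Lemma ex_RInt_of_continuous (f : R -> R) a b : (forall x, continuous f x) -> ex_RInt f a b.
Proof. intros H. apply (@ex_RInt_continuous R_CompleteNormedModule). auto. Qed.

Lemma abs_RInt_le_continuous (f : R -> R) a b M : (forall x, continuous f x) ->
  (forall x, Rabs (f x) <= M) -> Rabs (RInt f a b) <= M * Rabs (b - a).
Proof.
intros Hf HM. destruct (Rle_or_lt a b) as [H|H].
- rewrite (Rabs_pos_eq (b - a)), Rmult_comm by lra.
  apply abs_RInt_le_const; auto using ex_RInt_of_continuous.
- rewrite <- (opp_RInt_swap (V := R_CompleteNormedModule)) by now apply ex_RInt_of_continuous.
  change (Rabs (- RInt f b a) <= M * Rabs (b - a)).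
  rewrite Rabs_Ropp, Rabs_minus_sym, (Rabs_pos_eq (a - b)), Rmult_comm by lra.
  apply abs_RInt_le_const; auto using ex_RInt_of_continuous; lra.
Qed.

Lemma is_derive_RInt_continuous (f : R -> R) a x : (forall s, continuous f s) ->
  is_derive (fun x => RInt f a x) x (f x).
Proof.
intros Hf. apply (is_derive_RInt f _ a); trivial. apply filter_forall. intros s.
now apply (@RInt_correct R_CompleteNormedModule), ex_RInt_of_continuous.
Qed.

Lemma geometric_contraction_limit (Y : nat -> R -> R) C : 0 <= C ->
  (forall n x, Rabs (Y (S n) x - Y n x) <= C * (/ 2) ^ n) ->
  exists y, forall n x, Rabs (y x - Y n x) <= 2 * C * (/ 2) ^ n.
Proof.
intros HC HY.
assert (Hp : forall n, 0 < (/ 2) ^ n) by (intros; apply pow_lt; lra).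
(* The subtracted tail makes the induction on k close: C/2^m is exactly 2C/2^m - 2C/2^(m+1). *)
assert (H : forall x n k, Rabs (Y (n + k)%nat x - Y n x) <= 2 * C * (/ 2) ^ n - 2 * C * (/ 2)
  ^ (n + k)).
{ intros x n. induction k as [|k IH].
  - rewrite Nat.add_0_r, Rminus_eq_0, Rabs_R0. lra.
  - rewrite Nat.add_succ_r. assert (T := Rabs_triang (Y (S (n + k)) x - Y (n + k)%nat x) (Y
      (n + k)%nat x - Y n x)).
    replace (Y (S (n + k)) x - Y (n + k)%nat x + (Y (n + k)%nat x - Y n x)) with (Y (S (n +
      k)) x - Y n x) in T by ring.
    specialize (HY (n + k)%nat x). simpl. lra. }
assert (H' : forall x n m, (n <= m)%nat -> Rabs (Y m x - Y n x) <= 2 * C * (/ 2) ^ n).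
{ intros x n m Hm. replace m with (n + (m - n))%nat by lia.
  specialize (H x n (m - n)%nat). assert (Q := Hp (n + (m - n))%nat). nra. }
assert (Hlim : forall x, ex_finite_lim_seq (fun n => Y n x)).
{ intros x. apply ex_lim_seq_cauchy_corr. intros eps.
  assert (Heps := cond_pos eps).
  (* The summand 1 keeps the denominator positive when C = 0. *)
  assert (P : 0 < eps / (4 * C + 1)) by (apply Rdiv_lt_0_compat; lra).
  destruct (pow_lt_1_zero (/ 2) ltac:(rewrite Rabs_pos_eq; lra) _ P) as [N HN].
  exists N. intros n m Hn Hm.
  assert (T := Rabs_triang (Y n x - Y N x) (- (Y m x - Y N x))). rewrite Rabs_Ropp in T.
  replace (Y n x - Y N x + - (Y m x - Y N x)) with (Y n x - Y m x) in T by ring.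
  assert (A := H' x N n Hn). assert (B := H' x N m Hm).
  specialize (HN N (Nat.le_refl _)). rewrite Rabs_pos_eq in HN by (left; apply Hp).
  assert (4 * C * (/ 2) ^ N < eps); [|lra].
  apply Rmult_lt_compat_r with (r := 4 * C + 1) in HN; [|lra].
  unfold Rdiv in HN. rewrite Rmult_assoc, Rinv_l in HN by lra. specialize (Hp N). lra. }
exists (fun x => real (Lim_seq (fun n => Y n x))). intros n x.
assert (L := Lim_seq_correct' _ (Hlim x)).
assert (L1 : is_lim_seq (fun m => Y (m + n)%nat x) (Finite (real (Lim_seq (fun n => Y n
  x))))) by exact (proj1 (is_lim_seq_incr_n (fun m => Y m x) n _) L).
assert (L2 := is_lim_seq_abs _ _ (is_lim_seq_minus' _ _ _ _ L1 (is_lim_seq_const (Y n x)))).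
simpl in L2.
refine (is_lim_seq_le _ _ _ (2 * C * (/ 2) ^ n) _ L2 (is_lim_seq_const _)).
intros m. apply H'. lia.
Qed.

(** The iteration is run for the clamped field on the whole line. L r <= 1/2 makes the integral
    operator halve sup distances; M r <= rho keeps every iterate in the strip where clamping y does
    nothing, so the fixed point solves the original equation. *)
Theorem picard_lindelof F x0 y0 r rho M L : 0 < r -> 0 <= rho -> 0 <= M ->
  (forall x y, Rabs (x - x0) <= r -> Rabs (y - y0) <= rho ->
     continuity_2d_pt F x y /\ Rabs (F x y) <= M) ->
  (forall x y1 y2, Rabs (x - x0) <= r -> Rabs (y1 - y0) <= rho -> Rabs (y2 - y0) <= rho ->
     Rabs (F x y1 - F x y2) <= L * Rabs (y1 - y2)) ->
  M * r <= rho -> L * r <= / 2 -> 0 <= L ->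
  exists y, y x0 = y0 /\ forall x, Rabs (x - x0) < r ->
    Rabs (y x - y0) <= rho /\ is_derive y x (F x (y x)).
Proof.
intros Hr Hrho HM HF HL HMr HLr HL0.
pose (H x y := F (clamp x0 r x) (clamp y0 rho y)).
assert (Cr : forall x, Rabs (clamp x0 r x - x0) <= r) by (intros; apply clamp_bound; lra).
assert (Crho : forall y, Rabs (clamp y0 rho y - y0) <= rho) by (intros; now apply clamp_bound).
assert (cH : forall x y, continuity_2d_pt H x y).
{ intros x y. apply (continuity_2d_pt_comp F (fun x _ => clamp x0 r x) (fun _ y => clamp y0
    rho y)).
  - apply HF; trivial.
  - apply (continuity_1d_2d_pt_comp (clamp x0 r) (fun x _ => x));
      [apply clamp_continuous|apply continuity_2d_pt_id1].
  - apply (continuity_1d_2d_pt_comp (clamp y0 rho) (fun _ y => y));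
      [apply clamp_continuous|apply continuity_2d_pt_id2]. }
assert (bH : forall x y, Rabs (H x y) <= M) by (intros; apply HF; trivial).
assert (lH : forall x y1 y2, Rabs (H x y1 - H x y2) <= L * Rabs (y1 - y2)).
{ intros. unfold H. eapply Rle_trans; [now apply HL|]. apply Rmult_le_compat_l; trivial.
  apply clamp_lipschitz. }
(* The upper limit is clamped too, so that [T y] stays within rho of y0 on all of R and not only
   near x0. *)
pose (T y x := y0 + RInt (fun s => H s (y s)) x0 (clamp x0 r x)).
assert (cI : forall y : R -> R, (forall x, continuous y x) ->
  forall x, continuous (fun s => H s (y s)) x).
{ intros y Hy. now apply continuous_2d_slice. }
assert (cT : forall y : R -> R, (forall x, continuous y x) -> forall x, continuous (T y) x).
{ intros y Hy x. apply continuity_pt_filterlim. unfold T.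
  apply (continuity_pt_plus (fun _ => y0) (fun x => RInt (fun s => H s (y s)) x0 (clamp x0 r
    x))).
  { apply continuity_pt_const. now intros ? ?. }
  apply (continuity_pt_comp (clamp x0 r) (fun x => RInt (fun s => H s (y s)) x0 x)).
  { apply clamp_continuous. }
  apply continuity_pt_filterlim. apply (@ex_derive_continuous R_AbsRing R_NormedModule).
  eexists. now apply is_derive_RInt_continuous, cI. }
assert (bT : forall y : R -> R, (forall x, continuous y x) ->
  forall x, Rabs (T y x - y0) <= rho).
{ intros y Hy x. unfold T. rewrite Rplus_minus_l.
  eapply Rle_trans; [apply (abs_RInt_le_continuous _ _ _ M); auto|].
  apply Rle_trans with (2 := HMr). now apply Rmult_le_compat_l. }
assert (kT : forall (y z : R -> R) K, (forall x, continuous y x) ->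
  (forall x, continuous z x) ->
  (forall x, Rabs (y x - z x) <= K) -> forall x, Rabs (T y x - T z x) <= / 2 * K).
{ intros y z K Hy Hz HK x. unfold T.
  assert (HK0 : 0 <= K) by (apply Rle_trans with (2 := HK x0); apply Rabs_pos).
  rewrite Rminus_plus_l_l.
  rewrite <- (RInt_minus (V := R_CompleteNormedModule)) by (apply ex_RInt_of_continuous;
    now apply cI).
  eapply Rle_trans; [apply (abs_RInt_le_continuous _ _ _ (L * K))|].
  - intros s. apply (continuous_minus (fun s => H s (y s)) (fun s => H s (z s))); now apply cI.
  - intros s. eapply Rle_trans; [apply lH|]. now apply Rmult_le_compat_l.
  - rewrite Rmult_assoc, (Rmult_comm K), <- Rmult_assoc. apply Rmult_le_compat_r; trivial.
    apply Rle_trans with (2 := HLr). now apply Rmult_le_compat_l. }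
pose (Y := fix Y n := match n with O => fun _ : R => y0 | S n => T (Y n) end).
assert (cY : forall n x, continuous (Y n) x).
{ induction n as [|n IH]; [intros x; apply continuous_const|now apply cT]. }
destruct (geometric_contraction_limit Y rho) as [y Hy]; trivial.
{ induction n as [|n IH]; intros x.
  - rewrite Rmult_1_r. apply (bT (Y O)), (cY O).
  - change (Rabs (T (Y (S n)) x - T (Y n) x) <= rho * (/ 2 * (/ 2) ^ n)).
    replace (rho * (/ 2 * (/ 2) ^ n)) with (/ 2 * (rho * (/ 2) ^ n)) by ring. now apply kT. }
assert (Hsmall : forall e, 0 < e -> exists N, forall n, (N <= n)%nat ->
  2 * rho * (/ 2) ^ n < e).
{ intros e He.
  assert (P : 0 < e / (2 * rho + 1)) by (apply Rdiv_lt_0_compat; lra).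
  destruct (pow_lt_1_zero (/ 2) ltac:(rewrite Rabs_pos_eq; lra) _ P) as [N HN].
  exists N. intros n Hn. specialize (HN n Hn).
  assert (Hp : 0 < (/ 2) ^ n) by (apply pow_lt; lra).
  rewrite Rabs_pos_eq in HN by lra. apply Rmult_lt_compat_r with (r := 2 * rho + 1) in HN;
    [|lra].
  unfold Rdiv in HN. rewrite Rmult_assoc, Rinv_l in HN by lra. lra. }
assert (cy : forall x, continuous y x).
{ intros x. apply continuity_pt_filterlim.
  apply (CVU_continuity Y y x (mkposreal 1 Rlt_0_1)).
  - intros e He. destruct (Hsmall e He) as [N HN]. exists N. intros n x' Hn _.
    eapply Rle_lt_trans; [apply Hy|now apply HN].
  - intros n x' _. apply continuity_pt_filterlim, cY.
  - unfold Boule. rewrite Rminus_eq_0, Rabs_R0. apply Rlt_0_1. }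
assert (fix_y : forall x, y x = T y x).
{ intros x. apply Rminus_diag_uniq.
  (* If y and [T y] differed at x, a late iterate would contradict it: y is within rho/2^N of Y
     (N+1) = T (Y N), which is within rho/2^N of [T y]. *)
  destruct (Req_dec (y x - T y x) 0) as [E|E]; trivial. exfalso.
  apply Rabs_pos_lt in E. destruct (Hsmall _ E) as [N HN]. specialize (HN N (Nat.le_refl _)).
  assert (A := Hy (S N) x).
  assert (B := kT (Y N) y _ (cY N) cy (fun x => eq_ind _ (fun z => z <= _) (Hy N x) _
    (Rabs_minus_sym _ _)) x).
  assert (C := Rabs_triang (y x - Y (S N) x) (T (Y N) x - T y x)).
  change (Y (S N) x) with (T (Y N) x) in *.
  replace (y x - T (Y N) x + (T (Y N) x - T y x)) with (y x - T y x) in C by ring.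
  simpl in A. lra. }
exists y. split.
{ rewrite fix_y. unfold T. rewrite clamp_id by (rewrite Rminus_eq_0, Rabs_R0; lra).
  rewrite RInt_point. apply Rplus_0_r. }
intros x Hx.
assert (by_ : Rabs (y x - y0) <= rho) by (rewrite fix_y; now apply bT).
split; trivial.
replace (F x (y x)) with (0 + H x (y x)).
2: { unfold H. rewrite (clamp_id x0), (clamp_id y0); lra. }
apply is_derive_ext_loc with (fun x => y0 + RInt (fun s => H s (y s)) x0 x).
- assert (P : 0 < r - Rabs (x - x0)) by lra. exists (mkposreal _ P).
  intros z Hz. change (Rabs (z - x) < r - Rabs (x - x0)) in Hz.
  rewrite (fix_y z). unfold T. rewrite clamp_id; trivial.
  assert (Q := Rabs_triang (z - x) (x - x0)).
  replace (z - x + (x - x0)) with (z - x0) in Q by ring. lra.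
- apply (is_derive_plus (fun _ => y0) (fun x => RInt (fun s => H s (y s)) x0 x)).
  + apply (is_derive_const y0).
  + now apply (is_derive_RInt_continuous (fun s => H s (y s))), cI.
Qed.

(** * Mean value, Taylor and Gronwall estimates *)

Lemma is_derive_continuity_pt (f : R -> R) x l : is_derive f x l -> continuity_pt f x.
Proof.
intros H. apply continuity_pt_filterlim, (@ex_derive_continuous R_AbsRing R_NormedModule).
now exists l.
Qed.

Lemma mean_value_Rle (f df : R -> R) a b M :
  (forall x, Rmin a b <= x <= Rmax a b -> is_derive f x (df x) /\ Rabs (df x) <= M) ->
  Rabs (f b - f a) <= M * Rabs (b - a).
Proof.
intros H. destruct (MVT_gen f a b df) as (c & Hc & ->).
- intros x Hx. apply H. lra.
- intros x Hx. apply (is_derive_continuity_pt f x (df x)), H, Hx.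
- rewrite Rabs_mult. apply Rmult_le_compat_r; [apply Rabs_pos|]. now apply H.
Qed.

(** Two mean value steps give the constant M instead of the sharp M/2; only the quadratic order
    matters later. *)
Lemma taylor1_bound (f df ddf : R -> R) a b M :
  (forall x, Rmin a b <= x <= Rmax a b ->
     is_derive f x (df x) /\ is_derive df x (ddf x) /\ Rabs (ddf x) <= M) ->
  Rabs (f b - f a - (b - a) * df a) <= M * (b - a) ^ 2.
Proof.
intros H. destruct (MVT_gen f a b df) as (c & Hc & ->).
- intros x Hx. apply H. lra.
- intros x Hx. apply (is_derive_continuity_pt f x (df x)), H, Hx.
- replace (df c * (b - a) - (b - a) * df a) with ((df c - df a) * (b - a)) by ring.
  rewrite Rabs_mult, <- (pow2_abs (b - a)).
  replace (M * Rabs (b - a) ^ 2) with (M * Rabs (b - a) * Rabs (b - a)) by ring.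
  apply Rmult_le_compat_r; [apply Rabs_pos|].
  assert (HM : 0 <= M).
  { destruct (H c Hc) as (_ & _ & Q). apply Rle_trans with (2 := Q), Rabs_pos. }
  apply Rle_trans with (M * Rabs (c - a)).
  + apply mean_value_Rle with ddf. intros x Hx. apply H.
    revert Hx Hc. unfold Rmin, Rmax. repeat destruct Rle_dec; lra.
  + apply Rmult_le_compat_l; trivial.
    revert Hc. unfold Rmin, Rmax, Rabs. repeat destruct Rle_dec; repeat destruct Rcase_abs; lra.
Qed.

(** |f| need not be differentiable, so f^2 + e^2 is used. Its derivative is at most 2L f^2 + 2e|f|
    <= (2L+1)(f^2 + e^2) in absolute value, hence it decreases from a towards b after multiplication
    by exp(-K|x-a|) with K = 2L+1. The sign [sg] of b - a treats both directions at once. *)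
Lemma gronwall (f df : R -> R) a b L e : 0 <= L -> 0 <= e ->
  (forall x, Rmin a b <= x <= Rmax a b -> is_derive f x (df x) /\ Rabs (df x) <= L * Rabs (f
    x) + e) ->
  Rabs (f b) <= (Rabs (f a) + e) * exp ((2 * L + 1) * Rabs (b - a)).
Proof.
intros HL He H. set (K := 2 * L + 1).
assert (Hs : exists sg, b - a = sg * Rabs (b - a) /\ sg * sg = 1 /\ forall y, sg * y <= Rabs y).
{ destruct (Rle_lt_dec a b); [exists 1|exists (-1)];
  (split; [|split; [ring|intros y]]); unfold Rabs; destruct Rcase_abs; lra. }
destruct Hs as (sg & Hsg & Hsg2 & Hsg3).
assert (Hd : forall x, Rmin a b <= x <= Rmax a b ->
  is_derive (fun x => ((f x) ^ 2 + e ^ 2) * exp (- sg * K * (x - a))) x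
    ((2 * f x * df x - sg * K * ((f x) ^ 2 + e ^ 2)) * exp (- sg * K * (x - a)))).
{ intros x Hx. destruct (H x Hx) as [Hd _].
  auto_derive; [now exists (df x)|]. 
  replace (Derive (fun x : R => f x) x) with (df x) by (symmetry;
    now apply is_derive_unique). simpl. unfold Rminus. ring. }
destruct (MVT_gen (fun x => ((f x) ^ 2 + e ^ 2) * exp (- sg * K * (x - a))) a b
  (fun x => (2 * f x * df x - sg * K * ((f x) ^ 2 + e ^ 2)) * exp (- sg * K * (x - a)))) as
    (c & Hc & Heq).
{ intros x Hx. apply Hd. lra. }
{ intros x Hx. eapply is_derive_continuity_pt. now apply Hd. }
destruct (H c Hc) as [_ Hb].
assert (A0 := Rabs_pos (f c)). assert (A1 := Rabs_pos (b - a)). assert (A2 := Rabs_pos (f a)).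
assert (Hneg : 2 * sg * (f c * df c) - K * (f c ^ 2 + e ^ 2) <= 0).
{ assert (Q := Hsg3 (f c * df c)). rewrite Rabs_mult in Q.
  assert (Rabs (f c) * Rabs (df c) <= Rabs (f c) * (L * Rabs (f c) + e)) by (now apply
    Rmult_le_compat_l).
  rewrite <- (pow2_abs (f c)). unfold K. set (y := Rabs (f c)) in *.
  assert (0 <= (y - e) ^ 2) by apply pow2_ge_0. nra. }
assert (Hle : (f b ^ 2 + e ^ 2) * exp (- sg * K * (b - a)) <= f a ^ 2 + e ^ 2).
{ rewrite (Rminus_eq_0 a), Rmult_0_r, exp_0, Rmult_1_r in Heq.
  assert (Hx := exp_pos (- sg * K * (c - a))).
  set (X := exp (- sg * K * (c - a))) in *.
  assert (Hxx : 0 <= X * Rabs (b - a)) by (apply Rmult_le_pos; lra).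
  assert (Heq2 : (2 * f c * df c - sg * K * (f c ^ 2 + e ^ 2)) * X * (b - a)
    = (2 * sg * (f c * df c) - K * (f c ^ 2 + e ^ 2)) * (X * Rabs (b - a))).
  { rewrite Hsg at 1. replace K with (sg * sg * K) at 2 by (rewrite Hsg2; ring). ring. }
  nra. }
replace (- sg * K * (b - a)) with (- (sg * sg * (K * Rabs (b - a)))) in Hle by (rewrite Hsg
  at 2; ring).
rewrite Hsg2, Rmult_1_l in Hle.
assert (HK : 0 <= K * Rabs (b - a)) by (apply Rmult_le_pos; unfold K; lra).
set (k := K * Rabs (b - a)) in *. rewrite exp_Ropp in Hle.
assert (He1 : 1 <= exp k) by (assert (T := exp_ineq1_le k); lra).
set (E := exp k) in *. clearbody E.
assert (Hle2 : f b ^ 2 + e ^ 2 <= (f a ^ 2 + e ^ 2) * E).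
{ apply Rmult_le_reg_r with (/ E); [apply Rinv_0_lt_compat; lra|].
  rewrite Rmult_assoc, Rinv_r; lra. }
apply Rsqr_incr_0_var; [|apply Rmult_le_pos; lra].
rewrite <- (pow2_abs (f a)), <- (pow2_abs (f b)) in Hle2. unfold Rsqr.
(* Since E >= 1, E is bounded by its square; this spares a square root of the exponential. *)
assert ((Rabs (f a) ^ 2 + e ^ 2) * E <= (Rabs (f a) + e) ^ 2 * (E * E)).
{ apply Rmult_le_compat; nra. }
assert (0 <= e ^ 2) by apply pow2_ge_0. lra.
Qed.

(** * The Riccati connection *)

Definition square (x0 t0 r : R) : R -> R -> Prop :=
  rectangle (x0 - r) (x0 + r) (t0 - r) (t0 + r).

Lemma squareE x0 t0 r x t : square x0 t0 r x t <-> Rabs (x - x0) < r /\ Rabs (t - t0) < r.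
Proof.
unfold square, rectangle. simpl. split.
- intros (A & B & C & D). split; apply Rabs_def1; lra.
- intros [A B]. apply Rabs_def2 in A. apply Rabs_def2 in B. lra.
Qed.

Lemma locally_2d_abs_bound f x t : continuity_2d_pt f x t ->
  locally_2d (fun u v => Rabs (f u v) <= Rabs (f x t) + 1) x t.
Proof.
intros H. apply locally_2d_impl with (2 := H (mkposreal 1 Rlt_0_1)), locally_2d_forall.
simpl. intros u v Hu. assert (T := Rabs_triang (f u v - f x t) (f x t)).
replace (f u v - f x t + f x t) with (f u v) in T by ring. lra.
Qed.

Lemma smooth_on_bounded_near D f x t : smooth_on D f -> D x t ->
  exists B, 0 <= B /\ locally_2d (fun u v => Rabs (f u v) <= B) x t.
Proof.
intros Hf Hxt. exists (Rabs (f x t) + 1). split.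
- assert (A := Rabs_pos (f x t)). lra.
- now apply locally_2d_abs_bound, (smooth_on_continuous D).
Qed.

Lemma abs_between a b x r : Rabs (a - x) < r -> Rabs (b - x) < r ->
  forall y, Rmin a b <= y <= Rmax a b -> Rabs (y - x) < r.
Proof.
intros Ha Hb y Hy. apply Rabs_def2 in Ha. apply Rabs_def2 in Hb. apply Rabs_def1;
revert Hy; unfold Rmin, Rmax; destruct Rle_dec; lra.
Qed.

Section Riccati.

Variables (D : R -> R -> Prop) (A w : R -> R -> R) (x0 t0 : R).
Hypothesis open_D : open_2d D.
Hypothesis D0 : D x0 t0.
Hypothesis smooth_A : smooth_on D A.
Hypothesis smooth_w : smooth_on D w.
Hypothesis compatible : forall x t, D x t ->
  dt A x t = dx 3 w x t + 2 * dx 1 w x t * A x t + w x t * dx 1 A x t.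

Definition riccati_x (x t y : R) : R := A x t + y ^ 2 / 2.
(** The expansion of (w_x + w z)_x with z_x already replaced by its Riccati value, so that z_t
    becomes a function of z alone and can be integrated along x = x0. *)
Definition riccati_t (x t y : R) : R :=
  dx 2 w x t + dx 1 w x t * y + w x t * riccati_x x t y.

(** The bounds on A, w, w_x and w_xx control both right-hand sides; the one on A_tt is there for the
    Taylor remainder of A in time. *)
Lemma riccati_bounds : exists B r, 1 <= B /\ 0 < r /\ forall x t,
  Rabs (x - x0) <= r -> Rabs (t - t0) <= r -> D x t /\ Rabs (A x t) <= B /\
  Rabs (w x t) <= B /\ Rabs (dx 1 w x t) <= B /\ Rabs (dx 2 w x t) <= B /\
  Rabs (dt (dt A) x t) <= B.
Proof.
destruct (smooth_on_bounded_near D A x0 t0) as (B1 & P1 & H1); trivial.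
destruct (smooth_on_bounded_near D w x0 t0) as (B2 & P2 & H2); trivial.
destruct (smooth_on_bounded_near D (dx 1 w) x0 t0) as (B3 & P3 & H3); trivial.
{ now apply smooth_on_dx. }
destruct (smooth_on_bounded_near D (dx 2 w) x0 t0) as (B4 & P4 & H4); trivial.
{ now apply (smooth_on_dx D (dx 1 w)), smooth_on_dx. }
destruct (smooth_on_bounded_near D (dt (dt A)) x0 t0) as (B5 & P5 & H5); trivial.
{ now apply smooth_on_dt, smooth_on_dt. }
destruct (locally_2d_and _ _ _ _ (open_D _ _ D0) (locally_2d_and _ _ _ _ H1
  (locally_2d_and _ _ _ _ H2 (locally_2d_and _ _ _ _ H3 (locally_2d_and _ _ _ _ H4 H5))))) as
    [d Hd].
assert (Pd := cond_pos d).
exists (1 + B1 + B2 + B3 + B4 + B5), (d / 2). split; [lra|]. split; [lra|].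
intros x t Hx Ht. destruct (Hd x t) as (K0 & K1 & K2 & K3 & K4 & K5); [lra|lra|].
repeat split; trivial; lra.
Qed.

Lemma riccati_t_bound B x t y : 1 <= B -> Rabs (A x t) <= B -> Rabs (w x t) <= B ->
  Rabs (dx 1 w x t) <= B -> Rabs (dx 2 w x t) <= B -> Rabs y <= 1 ->
  Rabs (riccati_t x t y) <= 2 * B + B * (B + 1).
Proof.
intros HB H1 H2 H3 H4 Hy. unfold riccati_t, riccati_x.
assert (Y : 0 <= y ^ 2 <= 1).
{ rewrite <- pow2_abs. assert (T := Rabs_pos y). nra. }
assert (T1 := Rabs_triang (dx 2 w x t + dx 1 w x t * y) (w x t * (A x t + y ^ 2 / 2))).
assert (T2 := Rabs_triang (dx 2 w x t) (dx 1 w x t * y)).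
assert (T3 := Rabs_triang (A x t) (y ^ 2 / 2)).
rewrite Rabs_mult in T1, T2. rewrite (Rabs_pos_eq (y ^ 2 / 2)) in T3 by lra.
assert (Rabs (dx 1 w x t) * Rabs y <= B * 1) by (apply Rmult_le_compat; trivial;
  apply Rabs_pos).
assert (Rabs (w x t) * Rabs (A x t + y ^ 2 / 2) <= B * (B + 1)).
{ apply Rmult_le_compat; trivial; try apply Rabs_pos; lra. }
lra.
Qed.

(** Deliberately crude: sharing the bound of [riccati_t] lets one radius serve the integrations in
    both directions. *)
Lemma riccati_x_bound B x t y : 1 <= B -> Rabs (A x t) <= B -> Rabs y <= 1 ->
  Rabs (riccati_x x t y) <= 2 * B + B * (B + 1).
Proof.
intros HB H1 Hy. unfold riccati_x.
assert (Y : 0 <= y ^ 2 <= 1).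
{ rewrite <- pow2_abs. assert (T := Rabs_pos y). nra. }
assert (T3 := Rabs_triang (A x t) (y ^ 2 / 2)).
rewrite (Rabs_pos_eq (y ^ 2 / 2)) in T3 by lra. nra.
Qed.

Lemma sqr_lipschitz y1 y2 : Rabs y1 <= 1 -> Rabs y2 <= 1 ->
  Rabs (y1 ^ 2 / 2 - y2 ^ 2 / 2) <= Rabs (y1 - y2).
Proof.
intros H1 H2. replace (y1 ^ 2 / 2 - y2 ^ 2 / 2) with ((y1 + y2) / 2 * (y1 - y2)) by field.
rewrite Rabs_mult. rewrite <- (Rmult_1_l (Rabs (y1 - y2))) at 2.
apply Rmult_le_compat_r; [apply Rabs_pos|].
apply Rabs_le_between in H1. apply Rabs_le_between in H2. apply Rabs_le. lra.
Qed.

Lemma riccati_t_lipschitz B x t y1 y2 : 1 <= B -> Rabs (w x t) <= B -> Rabs (dx 1 w x t) <= B ->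
  Rabs y1 <= 1 -> Rabs y2 <= 1 -> Rabs (riccati_t x t y1 - riccati_t x t y2) <= 2 * B * Rabs
    (y1 - y2).
Proof.
intros HB H1 H2 Hy1 Hy2. unfold riccati_t, riccati_x.
replace (_ - _) with (dx 1 w x t * (y1 - y2) + w x t * (y1 ^ 2 / 2 - y2 ^ 2 / 2)) by field.
eapply Rle_trans; [apply Rabs_triang|]. rewrite 2!Rabs_mult.
assert (T := sqr_lipschitz y1 y2 Hy1 Hy2).
assert (Rabs (dx 1 w x t) * Rabs (y1 - y2) <= B * Rabs (y1 - y2)).
{ apply Rmult_le_compat_r; trivial. apply Rabs_pos. }
assert (Rabs (w x t) * Rabs (y1 ^ 2 / 2 - y2 ^ 2 / 2) <= B * Rabs (y1 - y2)).
{ apply Rmult_le_compat; trivial; apply Rabs_pos. }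
lra.
Qed.

(* The solution is integrated along [x = x0] first, and then along each line
   [t = const]. *)
Lemma riccati_cross_solution : exists B r z, 1 <= B /\ 0 < r /\
  (forall x t, Rabs (x - x0) <= r -> Rabs (t - t0) <= r -> D x t /\ Rabs (A x t) <= B /\
     Rabs (w x t) <= B /\ Rabs (dx 1 w x t) <= B /\ Rabs (dx 2 w x t) <= B /\
     Rabs (dt (dt A) x t) <= B) /\
  (forall x t, Rabs (x - x0) < r -> Rabs (t - t0) < r ->
     Rabs (z x t) <= 1 /\ is_derive (fun y => z y t) x (riccati_x x t (z x t))) /\
  (forall t, Rabs (t - t0) < r -> is_derive (fun s => z x0 s) t (riccati_t x0 t (z x0 t))).
Proof.
destruct riccati_bounds as (B & r0 & HB & Hr0 & Hb).
set (M := 2 * B + B * (B + 1)).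
assert (HM : 1 <= M) by (unfold M; nra).
(* 1/(2M) limits each integration to an excursion of 1/2, and 1/(4B) gives the contraction for the
   Lipschitz constant 2B. Starting from z = 0, the two successive excursions keep |z| <= 1, the
   range in which the bounds hold. *)
set (r := Rmin r0 (Rmin (/ (2 * M)) (/ (4 * B)))).
assert (Hr1 : r <= r0) by apply Rmin_l.
assert (Hr2 : r <= / (2 * M)) by (eapply Rle_trans; [apply Rmin_r|apply Rmin_l]).
assert (Hr3 : r <= / (4 * B)) by (eapply Rle_trans; [apply Rmin_r|apply Rmin_r]).
assert (Hr : 0 < r).
{ repeat apply Rmin_pos; trivial; apply Rinv_0_lt_compat; lra. }
assert (HMr : M * r <= / 2).
{ apply Rle_trans with (M * / (2 * M)); [apply Rmult_le_compat_l; lra|right; field; lra]. }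
assert (HLr : 2 * B * r <= / 2).
{ apply Rle_trans with (2 * B * / (4 * B)); [apply Rmult_le_compat_l; lra|right; field; lra]. }
assert (Hb' : forall x t, Rabs (x - x0) <= r -> Rabs (t - t0) <= r ->
  D x t /\ Rabs (A x t) <= B /\
     Rabs (w x t) <= B /\ Rabs (dx 1 w x t) <= B /\ Rabs (dx 2 w x t) <= B /\
     Rabs (dt (dt A) x t) <= B) by (intros; apply Hb; lra).
assert (Z : Rabs (x0 - x0) <= r) by (rewrite Rminus_eq_0, Rabs_R0; lra).
assert (cA := smooth_on_continuous D A smooth_A).
assert (cw := smooth_on_continuous D w smooth_w).
assert (cw1 := smooth_on_continuous D _ (smooth_on_dx D w smooth_w)).
assert (cw2 := smooth_on_continuous D _ (smooth_on_dx D _ (smooth_on_dx D w smooth_w))).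
assert (csq : forall u v, continuity_2d_pt (fun _ y => y ^ 2 / 2) u v).
{ intros u v. apply (continuity_1d_2d_pt_comp (fun y => y ^ 2 / 2) (fun _ y => y));
    [|apply continuity_2d_pt_id2].
  apply derivable_continuous_pt. apply ex_derive_Reals_0. auto_derive; trivial. }
assert (cfix : forall f, continuous_2d_on D f -> forall s y, D x0 s ->
  continuity_2d_pt (fun s _ => f x0 s) s y).
{ intros f Hf s y Hs. apply (continuity_2d_pt_comp f (fun _ _ => x0) (fun s _ => s));
    auto using continuity_2d_pt_const, continuity_2d_pt_id1. }
destruct (picard_lindelof (fun s y => riccati_t x0 s y) t0 0 r (/ 2) M (2 * B)) as (zeta &
  Hz0 & Hz); try lra.
{ intros s y Hs Hy. rewrite Rminus_0_r in Hy.
  destruct (Hb' x0 s Z Hs) as (K0 & K1 & K2 & K3 & K4 & K5).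
  split; [|apply riccati_t_bound; trivial; lra].
  unfold riccati_t, riccati_x. apply continuity_2d_pt_plus; [apply continuity_2d_pt_plus|].
  - now apply cfix.
  - apply continuity_2d_pt_mult; [now apply cfix|apply continuity_2d_pt_id2].
  - apply continuity_2d_pt_mult; [now apply cfix|].
    apply continuity_2d_pt_plus; [now apply cfix|apply csq]. }
{ intros s y1 y2 Hs Hy1 Hy2. rewrite Rminus_0_r in Hy1, Hy2.
  destruct (Hb' x0 s Z Hs) as (K0 & K1 & K2 & K3 & K4 & K5).
  apply riccati_t_lipschitz; trivial; lra. }
assert (Hx : forall t, exists y, Rabs (t - t0) < r ->
  y x0 = zeta t /\ forall x, Rabs (x - x0) < r ->
   Rabs (y x - zeta t) <= / 2 /\ is_derive y x (riccati_x x t (y x))).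
{ intros t. destruct (Rlt_dec (Rabs (t - t0)) r) as [Ht|Ht]; [|now exists (fun _ => 0)].
  destruct (Hz t Ht) as [Hzt _]. rewrite Rminus_0_r in Hzt.
  assert (Hy1 : forall y, Rabs (y - zeta t) <= / 2 -> Rabs y <= 1).
  { intros y Hy. assert (T := Rabs_triang (y - zeta t) (zeta t)).
    replace (y - zeta t + zeta t) with y in T by ring. lra. }
  destruct (picard_lindelof (fun x y => riccati_x x t y) x0 (zeta t) r (/ 2) M (2 * B)) as (y
    & H0 & Hy); try lra.
  - intros x y Hxx Hy. destruct (Hb' x t Hxx ltac:(lra)) as (K0 & K1 & K2 & K3 & K4 & K5).
    split; [|apply riccati_x_bound; auto].
    unfold riccati_x. apply continuity_2d_pt_plus; [|apply csq].
    apply (continuity_2d_pt_comp A (fun x _ => x) (fun _ _ => t));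
      auto using continuity_2d_pt_const, continuity_2d_pt_id1.
  - intros x y1 y2 _ H1 H2. unfold riccati_x.
    replace (_ - _) with (y1 ^ 2 / 2 - y2 ^ 2 / 2) by ring.
    eapply Rle_trans; [apply sqr_lipschitz; auto|]. assert (P := Rabs_pos (y1 - y2)). nra.
  - now exists y. }
(* Each line t = const gets its own independently chosen solution. Only on x = x0, where z equals
   [zeta], is the dependence on t known so far. *)
pose (z x t := proj1_sig (constructive_indefinite_description _ (Hx t)) x).
assert (Hzz : forall t, Rabs (t - t0) < r -> z x0 t = zeta t /\ forall x, Rabs (x - x0) < r ->
   Rabs (z x t - zeta t) <= / 2 /\ is_derive (fun x => z x t) x (riccati_x x t (z x t))).
{ intros t. unfold z. exact (proj2_sig (constructive_indefinite_description _ (Hx t))). }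
exists B, r, z. split; trivial. split; trivial. split; trivial. split.
- intros x t Hxx Ht. destruct (Hzz t Ht) as [_ H]. destruct (H x Hxx) as [H1 H2].
  split; trivial.
  destruct (Hz t Ht) as [Hzt _]. rewrite Rminus_0_r in Hzt.
  assert (T := Rabs_triang (z x t - zeta t) (zeta t)).
  replace (z x t - zeta t + zeta t) with (z x t) in T by ring. lra.
- intros t Ht. destruct (Hzz t Ht) as [-> _]. destruct (Hz t Ht) as [_ H].
  apply is_derive_ext_loc with zeta; trivial.
  assert (P : 0 < r - Rabs (t - t0)) by lra. exists (mkposreal _ P). intros s Hs.
  change (Rabs (s - t) < r - Rabs (t - t0)) in Hs. symmetry. apply Hzz.
  assert (T := Rabs_triang (s - t) (t - t0)).
  replace (s - t + (t - t0)) with (s - t0) in T by ring. lra.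
Qed.

(** Equality of mixed derivatives, and the place where [compatible] enters: g = [riccati_t] along an
    x-solution satisfies g_x = A_t + z g, which is the Riccati equation in x differentiated formally
    in t. *)
Lemma riccati_t_dx x t (z : R -> R) : D x t -> is_derive z x (riccati_x x t (z x)) ->
  is_derive (fun y => riccati_t y t (z y)) x (dt A x t + z x * riccati_t x t (z x)).
Proof.
intros Hxt Hz.
assert (H2 := is_derive_dx D w 2 x t smooth_w Hxt).
assert (H1 := is_derive_dx D w 1 x t smooth_w Hxt).
assert (H0 := proj1 (smooth_on_partials D w smooth_w x t Hxt)).
assert (HA := proj1 (smooth_on_partials D A smooth_A x t Hxt)).
unfold riccati_t, riccati_x. auto_derive.
- repeat split; eexists; eassumption.
- replace (Derive (fun y : R => dx 2 w y t) x) with (dx 3 w x t) by (symmetry;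
    now apply is_derive_unique).
  replace (Derive (fun y : R => dx 1 w y t) x) with (dx 2 w x t) by (symmetry;
    now apply is_derive_unique).
  replace (Derive (fun y : R => w y t) x) with (dx 1 w x t) by (symmetry;
    now apply is_derive_unique).
  replace (Derive (fun y : R => A y t) x) with (dx 1 A x t) by (symmetry;
    now apply is_derive_unique).
  replace (Derive (fun y : R => z y) x) with (riccati_x x t (z x)) by (symmetry;
    now apply is_derive_unique).
  rewrite compatible by trivial. unfold riccati_x. field.
Qed.

(** The x-equation holds by construction and the t-equation only on x = x0. The defect of a
    first-order expansion in time is o(s-t) there, and Gronwall's estimate along the line carries
    this over to every x. *)
Theorem riccati_frobenius : exists r z, 0 < r /\
  (forall x t, square x0 t0 r x t -> D x t) /\ smooth_on (square x0 t0 r) z /\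
  has_partials (square x0 t0 r) z (fun x t => riccati_x x t (z x t)) (fun x t => riccati_t x
    t (z x t)).
Proof.
destruct riccati_cross_solution as (B & r & z & HB & Hr & Hb & Hz & Hz0).
assert (HE : open_2d (square x0 t0 r)) by apply open_2d_rectangle.
set (M := 2 * B + B * (B + 1)).
assert (HM : 1 <= M) by (unfold M; nra).
assert (HD : forall x t, square x0 t0 r x t -> D x t).
{ intros x t Hxt. apply squareE in Hxt as [H1 H2]. apply Hb; lra. }
exists r, z. split; trivial. split; trivial.
assert (Dt : forall x t, Rabs (x - x0) < r -> Rabs (t - t0) < r ->
  is_derive (fun s => z x s) t (riccati_t x t (z x t))).
{ intros x t Hx Ht.
  pose (def s y := z y s - z y t - (s - t) * riccati_t y t (z y t)).
  assert (Hdef : forall s, Rabs (s - t0) < r -> Rabs (s - t) <= 1 ->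
    Rabs (def s x) <= (Rabs (def s x0) + (B + M ^ 2 / 2) * (s - t) ^ 2) * exp ((2 * ((2 + M)
      / 2) + 1) * Rabs (x - x0))).
  { intros s Hs Hst.
    apply (gronwall (def s) (fun y => riccati_x y s (z y s) - riccati_x y t (z y t) - (s - t)
      * (dt A y t + z y t * riccati_t y t (z y t)))).
    - lra.
    - apply Rmult_le_pos; [|apply pow2_ge_0]. assert (T := pow2_ge_0 M). lra.
    - intros y Hy.
      assert (Hyx : Rabs (y - x0) < r).
      { apply (abs_between x0 x x0 r); trivial. rewrite Rminus_eq_0, Rabs_R0; lra. }
      destruct (Hb y t ltac:(lra) ltac:(lra)) as (K0 & K1 & K2 & K3 & K4 & K5).
      destruct (Hz y t Hyx Ht) as [Z1 Z2]. destruct (Hz y s Hyx Hs) as [Z3 Z4].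
      split.
      { apply (is_derive_minus (fun y => z y s - z y t) (fun y => (s - t) * riccati_t y t (z
          y t))).
        - now apply (is_derive_minus (fun y => z y s) (fun y => z y t)).
        - apply (is_derive_scal (fun y => riccati_t y t (z y t))).
          now apply (riccati_t_dx y t (fun y => z y t)). }
      assert (G := riccati_t_bound B y t (z y t) HB K1 K2 K3 K4 Z1). fold M in G.
      set (g := riccati_t y t (z y t)) in *.
      assert (Tay : Rabs (A y s - A y t - (s - t) * dt A y t) <= B * (s - t) ^ 2).
      { apply (taylor1_bound (fun s => A y s) (fun s => dt A y s) (fun s => dt (dt A) y s)).
        intros s' Hs'. assert (Hs'' := abs_between t s t0 r Ht Hs s' Hs').
        destruct (Hb y s' ltac:(lra) ltac:(lra)) as (L0 & L1 & L2 & L3 & L4 & L5).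
        split; [now apply (smooth_on_partials D)|]. split; trivial.
        apply (smooth_on_partials D); trivial. now apply smooth_on_dt. }
      assert (Hd : z y s = z y t + (s - t) * g + def s y) by (unfold def; fold g; ring).
      set (h := s - t) in *. set (e := def s y) in *.
      unfold riccati_x.
      (* Substituting z(y,s) = z(y,t) + h g + e cancels the terms linear in h. What remains is the
         Taylor remainder of A, the defect e with a coefficient bounded by (2+M)/2 (here |h| <= 1 is
         used), and (h g)^2/2. *)
      replace (A y s + z y s ^ 2 / 2 - (A y t + z y t ^ 2 / 2) - h * (dt A y t + z y t * g))
        with ((A y s - A y t - h * dt A y t) + (e * ((z y s + z y t + h * g) / 2) + (h * g) ^
          2 / 2))
        by (rewrite Hd; field).
      eapply Rle_trans; [apply Rabs_triang|].
      assert (T := Rabs_triang (e * ((z y s + z y t + h * g) / 2)) ((h * g) ^ 2 / 2)).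
      assert (Hg2 : (h * g) ^ 2 <= M ^ 2 * h ^ 2).
      { rewrite Rpow_mult_distr, Rmult_comm. apply Rmult_le_compat_r; [apply pow2_ge_0|].
        apply pow_maj_Rabs; trivial. }
      rewrite (Rabs_pos_eq ((h * g) ^ 2 / 2)) in T by (assert (T' := pow2_ge_0 (h * g)); lra).
      rewrite Rabs_mult in T.
      assert (Hhg : Rabs (h * g) <= M).
      { rewrite Rabs_mult. assert (P := Rabs_pos g). assert (P' := Rabs_pos h). nra. }
      assert (Hc : Rabs ((z y s + z y t + h * g) / 2) <= (2 + M) / 2).
      { apply Rabs_le_between in Z1. apply Rabs_le_between in Z3.
        apply Rabs_le_between in Hhg. apply Rabs_le. lra. }
      assert (Rabs e * Rabs ((z y s + z y t + h * g) / 2) <= Rabs e * ((2 + M) / 2)).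
      { apply Rmult_le_compat_l; trivial. apply Rabs_pos. }
      lra. }
  set (E := exp ((2 * ((2 + M) / 2) + 1) * Rabs (x - x0))) in *.
  assert (PE : 0 < E) by apply exp_pos.
  set (C := B + M ^ 2 / 2) in *.
  assert (HC : 0 < C) by (unfold C; assert (T := pow2_ge_0 M); lra).
  apply is_derive_Reals. intros eps Heps.
  (* The defect at x0 and the quadratic source each receive eps |h|/(4E); after multiplication by
     the Gronwall factor E they total eps |h|/2. *)
  assert (P1 : 0 < eps / (4 * E)) by (apply Rdiv_lt_0_compat; lra).
  assert (D0' := Hz0 t Ht). apply is_derive_Reals in D0'.
  destruct (D0' _ P1) as [d Hd].
  assert (P2 : 0 < r - Rabs (t - t0)) by lra.
  assert (P3 : 0 < eps / (4 * E * C)) by (apply Rdiv_lt_0_compat; trivial;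
    apply Rmult_lt_0_compat; lra).
  pose (m1 := mkposreal _ (Rmin_stable_in_posreal d (mkposreal _ P2))).
  pose (m2 := mkposreal _ (Rmin_stable_in_posreal (mkposreal _ Rlt_0_1) (mkposreal _ P3))).
  exists (mkposreal _ (Rmin_stable_in_posreal m1 m2)). simpl. intros h Hh0 Hh.
  apply Rmin_Rgt in Hh as [Hh Hh']. apply Rmin_Rgt in Hh as [h1 h2].
  apply Rmin_Rgt in Hh' as [h3 h4].
  assert (Hs : Rabs (t + h - t0) < r).
  { assert (T := Rabs_triang (t - t0) h). replace (t - t0 + h) with (t + h - t0) in T by
      ring. lra. }
  assert (Hst : t + h - t = h) by ring.
  specialize (Hdef (t + h) Hs). unfold def in Hdef. rewrite Hst in Hdef.
  specialize (Hdef ltac:(lra)).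
  specialize (Hd h Hh0 h1).
  set (gx := riccati_t x t (z x t)) in *. set (g0 := riccati_t x0 t (z x0 t)) in *.
  assert (Ph : 0 < Rabs h) by now apply Rabs_pos_lt.
  assert (Q0 : Rabs (z x0 (t + h) - z x0 t - h * g0) < eps / (4 * E) * Rabs h).
  { replace (z x0 (t + h) - z x0 t - h * g0) with (((z x0 (t + h) - z x0 t) / h - g0) * h) by
      (field; trivial).
    rewrite Rabs_mult. now apply Rmult_lt_compat_r. }
  replace ((z x (t + h) - z x t) / h - gx) with ((z x (t + h) - z x t - h * gx) / h) by
    (field; trivial).
  unfold Rdiv. rewrite Rabs_mult, Rabs_inv.
  apply Rmult_lt_reg_r with (Rabs h); trivial. rewrite Rmult_assoc, Rinv_l, Rmult_1_r by lra.
  eapply Rle_lt_trans; [exact Hdef|].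
  rewrite <- (pow2_abs h).
  assert (Q1 : C * Rabs h ^ 2 <= eps / (4 * E) * Rabs h).
  { replace (C * Rabs h ^ 2) with (C * Rabs h * Rabs h) by ring.
    apply Rmult_le_compat_r; [lra|].
    apply Rle_trans with (C * (eps / (4 * E * C))); [apply Rmult_le_compat_l; lra|right;
      field; lra]. }
  apply Rlt_le_trans with ((eps / (4 * E) * Rabs h + eps / (4 * E) * Rabs h) * E).
  - apply Rmult_lt_compat_r; lra.
  - replace ((eps / (4 * E) * Rabs h + eps / (4 * E) * Rabs h) * E) with (eps * Rabs h / 2)
      by (field; lra).
    assert (0 < eps * Rabs h) by (now apply Rmult_lt_0_compat). lra. }
assert (HP : has_partials (square x0 t0 r) z (fun x t => riccati_x x t (z x t)) (fun x t =>
  riccati_t x t (z x t))).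
{ intros x t Hxt. apply squareE in Hxt as [H1 H2]. split; [now apply Hz|now apply Dt]. }
split; trivial.
apply smooth_closure_smooth with (fun h => h = z); trivial. 2: now apply sc_gen.
intros h ->.
assert (Sz : smooth_closure (fun h => h = z) (square x0 t0 r) z) by now apply sc_gen.
assert (Ss : forall f, smooth_on D f -> smooth_closure (fun h => h = z) (square x0 t0 r) f).
{ intros f Hf. now apply sc_smooth, (smooth_on_subset _ D). }
assert (Srx : smooth_closure (fun h => h = z) (square x0 t0 r) (fun x t => riccati_x x t (z x
  t))).
{ apply (sc_plus _ _ A (fun x t => z x t ^ 2 / 2)); [now apply Ss|].
  apply (sc_mult _ _ (fun x t => z x t ^ 2) (fun _ _ => / 2));
    [|apply sc_smooth, smooth_on_const].
  apply (sc_mult _ _ z (fun x t => z x t ^ 1)); trivial.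
  apply (sc_mult _ _ z (fun x t => 1)); trivial. apply sc_smooth, smooth_on_const. }
split.
(* Continuity cannot come from total differentiability, which would presuppose continuity of z_x and
   hence of z. Instead z is M-Lipschitz in x uniformly in t, and differentiable in t on each
   vertical line. *)
- intros x t Hxt. apply squareE in Hxt as [Hx Ht].
  assert (Ct := is_derive_continuity_pt _ _ _ (Dt x t Hx Ht)).
  intros eps. destruct (Ct (eps / 2)) as (d & Hd & Hcont). { assert (P := cond_pos eps). lra. }
  assert (P1 : 0 < r - Rabs (x - x0)) by lra. assert (P2 : 0 < r - Rabs (t - t0)) by lra.
  assert (P3 : 0 < eps / (2 * M)) by (apply Rdiv_lt_0_compat; [apply cond_pos|lra]).
  pose (m1 := mkposreal _ (Rmin_stable_in_posreal (mkposreal d Hd) (mkposreal _ P3))).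
  pose (m2 := mkposreal _ (Rmin_stable_in_posreal (mkposreal _ P1) (mkposreal _ P2))).
  exists (mkposreal _ (Rmin_stable_in_posreal m1 m2)). simpl. intros u v Hu Hv.
  apply Rmin_Rgt in Hu as [Hu Hu']. apply Rmin_Rgt in Hu as [u1 u2].
  apply Rmin_Rgt in Hu' as [u3 u4].
  apply Rmin_Rgt in Hv as [Hv Hv']. apply Rmin_Rgt in Hv as [v1 v2].
  apply Rmin_Rgt in Hv' as [v3 v4].
  assert (Hux : Rabs (u - x0) < r).
  { assert (T := Rabs_triang (u - x) (x - x0)).
    replace (u - x + (x - x0)) with (u - x0) in T by ring. lra. }
  assert (Hvt : Rabs (v - t0) < r).
  { assert (T := Rabs_triang (v - t) (t - t0)).
    replace (v - t + (t - t0)) with (v - t0) in T by ring. lra. }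
  assert (Q1 : Rabs (z u v - z x v) <= M * Rabs (u - x)).
  { apply (mean_value_Rle (fun y => z y v) (fun y => riccati_x y v (z y v))). intros y Hy.
    assert (Hyx := abs_between x u x0 r Hx Hux y Hy).
    destruct (Hz y v Hyx Hvt) as [Z1 Z2]. split; trivial.
    apply riccati_x_bound; trivial. apply Hb; lra. }
  assert (Q2 : Rabs (z x v - z x t) < eps / 2).
  { destruct (Req_dec t v) as [<-|N].
    - rewrite Rminus_eq_0, Rabs_R0. assert (P := cond_pos eps). lra.
    - apply (Hcont v). split; trivial. now split. }
  assert (Q3 : M * Rabs (u - x) < eps / 2).
  { apply Rlt_le_trans with (M * (eps / (2 * M))); [apply Rmult_lt_compat_l; lra|right;
      field; lra]. }
  assert (T := Rabs_triang (z u v - z x v) (z x v - z x t)).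
  replace (z u v - z x v + (z x v - z x t)) with (z u v - z x t) in T by ring. lra.
- exists (fun x t => riccati_x x t (z x t)), (fun x t => riccati_t x t (z x t)).
  split; trivial. split; trivial.
  apply (sc_plus _ _ (fun x t => dx 2 w x t + dx 1 w x t * z x t) (fun x t => w x t *
    riccati_x x t (z x t))).
  + apply (sc_plus _ _ (dx 2 w) (fun x t => dx 1 w x t * z x t)).
    * now apply Ss, (smooth_on_dx D (dx 1 w)), smooth_on_dx.
    * apply (sc_mult _ _ (dx 1 w) z); trivial. now apply Ss, smooth_on_dx.
  + apply (sc_mult _ _ w (fun x t => riccati_x x t (z x t))); trivial. now apply Ss.
Qed.

End Riccati.

(** * The hodograph transformation *)

Lemma Derive_dx f n x t : Derive (fun y => dx n f y t) x = dx (S n) f x t.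
Proof. reflexivity. Qed.

Lemma dx_succ_eq D f g n x t l : open_2d D -> D x t ->
  (forall y s, D y s -> dx n f y s = g y s) -> is_derive (fun y => g y t) x l ->
  dx (S n) f x t = l.
Proof.
intros HD Hxt Hfg Hg. rewrite <- Derive_dx. apply is_derive_unique.
apply is_derive_ext_loc with (fun y => g y t); trivial.
generalize (proj1 (open_slices D x t HD Hxt)). apply filter_imp. intros y Hy. now rewrite Hfg.
Qed.

Lemma dt_eq D f g x t l : open_2d D -> D x t ->
  (forall y s, D y s -> f y s = g y s) -> is_derive (fun s => g x s) t l ->
  dt f x t = l.
Proof.
intros HD Hxt Hfg Hg. apply is_derive_unique.
apply is_derive_ext_loc with (fun s => g x s); trivial.
generalize (proj2 (open_slices D x t HD Hxt)). apply filter_imp. intros y Hy. now rewrite Hfg.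
Qed.

Lemma dt_dx_comm D f x t : open_2d D -> smooth_on D f -> D x t ->
  dt (dx 1 f) x t = dx 1 (dt f) x t.
Proof.
intros HD Hf Hxt. symmetry. apply (Schwarz f x t).
- apply locally_2d_impl with (2 := HD x t Hxt), locally_2d_forall. intros u v Huv.
  destruct (smooth_on_partials D f Hf u v Huv).
  destruct (smooth_on_partials D _ (smooth_on_dx D f Hf) u v Huv).
  destruct (smooth_on_partials D _ (smooth_on_dt D f Hf) u v Huv).
  repeat split; eexists; eassumption.
- apply (smooth_on_continuous D (dx 1 (dt f))); trivial. now apply smooth_on_dx, smooth_on_dt.
- apply (smooth_on_continuous D (dt (dx 1 f))); trivial. now apply smooth_on_dt, smooth_on_dx.
Qed.

Lemma is_derive_dt_dx D f n x t : open_2d D -> smooth_on D f -> D x t ->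
  is_derive (fun s => dx n f x s) t (dx n (dt f) x t).
Proof.
intros HD Hf. revert x t. induction n as [|n IH]; intros x t Hxt.
- now apply (smooth_on_partials D f).
- assert (Hn := smooth_on_dx_n D f n Hf).
  assert (E : dt (dx 1 (dx n f)) x t = dx (S n) (dt f) x t).
  { rewrite (dt_dx_comm D) by trivial. symmetry.
    apply (dx_succ_eq D _ (dt (dx n f))); trivial.
    - intros y s Hys. symmetry. apply is_derive_unique. now apply IH.
    - apply (smooth_on_partials D); trivial. now apply smooth_on_dt. }
  rewrite <- E.
  exact (proj2 (smooth_on_partials D _ (smooth_on_dx D _ Hn) x t Hxt)).
Qed.

(* A function transported by [u_t = w u_x] has its Schwarzian derivative
   transported as a quadratic differential, up to the cocycle [w_xxx]. *)
Lemma Schwarzian_transport D u w : open_2d D -> smooth_on D u -> smooth_on D w ->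
  (forall x t, D x t -> dx 1 u x t <> 0) ->
  (forall x t, D x t -> dt u x t = w x t * dx 1 u x t) ->
  forall x t, D x t -> dt (Schwarzian u) x t =
    dx 3 w x t + 2 * dx 1 w x t * Schwarzian u x t + w x t * dx 1 (Schwarzian u) x t.
Proof.
intros HD Hu Hw H0 Ht.
assert (Dw : forall n x t, D x t -> is_derive (fun y => dx n w y t) x (dx (S n) w x t)).
{ intros. now apply (is_derive_dx D). }
assert (Du : forall n x t, D x t -> is_derive (fun y => dx n u y t) x (dx (S n) u x t)).
{ intros. now apply (is_derive_dx D). }
assert (Dw0 : forall x t, D x t -> is_derive (fun y => w y t) x (dx 1 w x t)).
{ intros x t Hxt. exact (Dw 0%nat x t Hxt). }
assert (E1 : forall x t, D x t -> dx 1 (dt u) x t = dx 1 w x t * dx 1 u x t + w x t * dx 2 u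
  x t).
{ intros x t Hxt. apply (dx_succ_eq D _ (fun x t => w x t * dx 1 u x t)); trivial.
  apply (is_derive_mult (fun y => w y t) (fun y => dx 1 u y t)); auto. exact Rmult_comm. }
assert (E2 : forall x t, D x t -> dx 2 (dt u) x t = dx 2 w x t * dx 1 u x t + 2 * dx 1 w x t
  * dx 2 u x t + w x t * dx 3 u x t).
{ intros x t Hxt. apply (dx_succ_eq D _ (fun x t => dx 1 w x t * dx 1 u x t + w x t * dx 2 u
    x t)); trivial.
  replace (_ + _) with ((dx 2 w x t * dx 1 u x t + dx 1 w x t * dx 2 u x t) + (dx 1 w x t *
    dx 2 u x t + w x t * dx 3 u x t)) by ring.
  apply (is_derive_plus (fun y => dx 1 w y t * dx 1 u y t) (fun y => w y t * dx 2 u y t)).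
  - apply (is_derive_mult (fun y => dx 1 w y t) (fun y => dx 1 u y t)); auto. exact Rmult_comm.
  - apply (is_derive_mult (fun y => w y t) (fun y => dx 2 u y t)); auto. exact Rmult_comm. }
assert (E3 : forall x t, D x t -> dx 3 (dt u) x t = dx 3 w x t * dx 1 u x t + 3 * dx 2 w x t
  * dx 2 u x t + 3 * dx 1 w x t * dx 3 u x t + w x t * dx 4 u x t).
{ intros x t Hxt. apply (dx_succ_eq D _ (fun x t => dx 2 w x t * dx 1 u x t + 2 * dx 1 w x t
    * dx 2 u x t + w x t * dx 3 u x t)); trivial.
  assert (A0 := Dw0 x t Hxt). assert (A1 := Dw 1%nat x t Hxt). assert (A2 := Dw 2%nat x t Hxt).
  assert (B1 := Du 1%nat x t Hxt). assert (B2 := Du 2%nat x t Hxt).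
  assert (B3 := Du 3%nat x t Hxt).
  auto_derive.
  - repeat split; eexists; eassumption.
  - replace (Derive (fun y : R => w y t) x) with (dx 1 w x t) by (symmetry;
      now apply is_derive_unique).
    replace (Derive (fun y : R => dx 1 w y t) x) with (dx 2 w x t) by (symmetry;
      now apply is_derive_unique).
    replace (Derive (fun y : R => dx 2 w y t) x) with (dx 3 w x t) by (symmetry;
      now apply is_derive_unique).
    replace (Derive (fun y : R => dx 1 u y t) x) with (dx 2 u x t) by (symmetry;
      now apply is_derive_unique).
    replace (Derive (fun y : R => dx 2 u y t) x) with (dx 3 u x t) by (symmetry;
      now apply is_derive_unique).
    replace (Derive (fun y : R => dx 3 u y t) x) with (dx 4 u x t) by (symmetry;
      now apply is_derive_unique).
    ring. }
intros x t Hxt. assert (N := H0 x t Hxt).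
assert (Sx : dx 1 (Schwarzian u) x t = dx 4 u x t / dx 1 u x t - 4 * dx 3 u x t * dx 2 u x t
  / dx 1 u x t ^ 2
  + 3 * dx 2 u x t ^ 3 / dx 1 u x t ^ 3).
{ apply is_derive_unique. unfold Schwarzian.
  assert (B1 := Du 1%nat x t Hxt). assert (B2 := Du 2%nat x t Hxt).
  assert (B3 := Du 3%nat x t Hxt).
  auto_derive.
  - repeat split; trivial; try (eexists; eassumption). rewrite Rmult_1_r.
    now apply Rmult_integral_contrapositive.
  - replace (Derive (fun y : R => dx 1 u y t) x) with (dx 2 u x t) by (symmetry;
      now apply is_derive_unique).
    replace (Derive (fun y : R => dx 2 u y t) x) with (dx 3 u x t) by (symmetry;
      now apply is_derive_unique).
    replace (Derive (fun y : R => dx 3 u y t) x) with (dx 4 u x t) by (symmetry;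
      now apply is_derive_unique).
    now field. }
rewrite Sx. apply is_derive_unique. unfold Schwarzian.
assert (B1 := is_derive_dt_dx D u 1 x t HD Hu Hxt).
assert (B2 := is_derive_dt_dx D u 2 x t HD Hu Hxt).
assert (B3 := is_derive_dt_dx D u 3 x t HD Hu Hxt).
rewrite E1 in B1 by trivial. rewrite E2 in B2 by trivial. rewrite E3 in B3 by trivial.
auto_derive.
- repeat split; trivial; try (eexists; eassumption). rewrite Rmult_1_r.
  now apply Rmult_integral_contrapositive.
- apply is_derive_unique in B1. apply is_derive_unique in B2. apply is_derive_unique in B3.
  replace (Derive (fun y : R => dx 1 u x y) t) with (dx 1 w x t * dx 1 u x t + w x t * dx 2 u
    x t) by (symmetry; exact B1).
  replace (Derive (fun y : R => dx 2 u x y) t) with (dx 2 w x t * dx 1 u x t + 2 * dx 1 w x t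
    * dx 2 u x t + w x t * dx 3 u x t) by (symmetry; exact B2).
  replace (Derive (fun y : R => dx 3 u x y) t) with (dx 3 w x t * dx 1 u x t + 3 * dx 2 w x t
    * dx 2 u x t + 3 * dx 1 w x t * dx 3 u x t + w x t * dx 4 u x t) by (symmetry; exact B3).
  now field.
Qed.

(* With [p = 1 / sqrt S[u]], this is [S[V]] in the variables (x,t). *)
Definition inverse_Schwarzian (p : R -> R -> R) (x t : R) : R :=
  p x t * dx 2 p x t - (dx 1 p x t) ^ 2 / 2.

Lemma smooth_on_inverse_Schwarzian D p : open_2d D -> smooth_on D p ->
  smooth_on D (inverse_Schwarzian p).
Proof.
intros HD Hp.
assert (H1 := smooth_on_dx_n D p 1 Hp). assert (H2 := smooth_on_dx_n D p 2 Hp).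
apply (smooth_on_minus D (fun x t => p x t * dx 2 p x t) (fun x t => dx 1 p x t ^ 2 / 2));
  trivial.
- now apply (smooth_on_mult D p (dx 2 p)).
- apply smooth_on_ext with (fun x t => / 2 * (dx 1 p x t * dx 1 p x t)); trivial.
  { intros; field. }
  apply (smooth_on_scal D (/ 2) (fun x t => dx 1 p x t * dx 1 p x t)); trivial.
  now apply (smooth_on_mult D (dx 1 p) (dx 1 p)).
Qed.

(** The products p_x p_xx cancel, so that p p_xxx is an exact x-derivative; this gives the
    conservation law its flux. *)
Lemma dx_inverse_Schwarzian D p x t : smooth_on D p -> D x t ->
  dx 1 (inverse_Schwarzian p) x t = p x t * dx 3 p x t.
Proof.
intros Hp Hxt. apply is_derive_unique. unfold inverse_Schwarzian.
assert (B0 : is_derive (fun y => p y t) x (dx 1 p x t)) by exact (is_derive_dx D p 0 x t Hp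
  Hxt).
assert (B1 := is_derive_dx D p 1 x t Hp Hxt). assert (B2 := is_derive_dx D p 2 x t Hp Hxt).
auto_derive.
- repeat split; eexists; eassumption.
- replace (Derive (fun y : R => p y t) x) with (dx 1 p x t) by (symmetry;
    now apply is_derive_unique).
  replace (Derive (fun y : R => dx 1 p y t) x) with (dx 2 p x t) by (symmetry;
    now apply is_derive_unique).
  replace (Derive (fun y : R => dx 2 p y t) x) with (dx 3 p x t) by (symmetry;
    now apply is_derive_unique).
  field.
Qed.

(** Along V, the derivative in X acts on functions of (x,t) as p d/dx. Hence V_XX = p p_x and V_XXX
    = p p_x^2 + p^2 p_xx, and S[V] = p p_xx + p_x^2 - (3/2) p_x^2. *)
Lemma Schwarzian_inverse (Omega D : R -> R -> Prop) V p k : open_2d Omega -> smooth_on D p ->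
  (forall X T, Omega X T -> D (V X T) (k * T) /\ p (V X T) (k * T) <> 0 /\
     is_derive (fun Y => V Y T) X (p (V X T) (k * T))) ->
  forall X T, Omega X T -> Schwarzian V X T = inverse_Schwarzian p (V X T) (k * T).
Proof.
intros HO Hp HV.
assert (C : forall n X T, Omega X T -> is_derive (fun Y => dx n p (V Y T) (k * T)) X
   (p (V X T) (k * T) * dx (S n) p (V X T) (k * T))).
{ intros n X T HXT. destruct (HV X T HXT) as (H1 & _ & H2).
  apply (is_derive_comp (fun y => dx n p y (k * T)) (fun Y => V Y T)); trivial.
  now apply (is_derive_dx D). }
assert (E1 : forall X T, Omega X T -> dx 1 V X T = p (V X T) (k * T)).
{ intros X T HXT. now apply is_derive_unique, HV. }
assert (E2 : forall X T, Omega X T -> dx 2 V X T = p (V X T) (k * T) * dx 1 p (V X T) (k * T)).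
{ intros X T HXT. apply (dx_succ_eq Omega _ (fun X T => p (V X T) (k * T))); trivial.
  exact (C 0%nat X T HXT). }
assert (E3 : forall X T, Omega X T -> dx 3 V X T = p (V X T) (k * T) * dx 1 p (V X T) (k * T)
  * dx 1 p (V X T) (k * T)
  + p (V X T) (k * T) * (p (V X T) (k * T) * dx 2 p (V X T) (k * T))).
{ intros X T HXT. apply (dx_succ_eq Omega _ (fun X T => p (V X T) (k * T) * dx 1 p (V X T) (k
    * T))); trivial.
  apply (is_derive_mult (fun X => p (V X T) (k * T)) (fun X => dx 1 p (V X T) (k * T))).
  - exact (C 0%nat X T HXT).
  - exact (C 1%nat X T HXT).
  - exact Rmult_comm. }
intros X T HXT. unfold Schwarzian, inverse_Schwarzian.
rewrite E1, E2, E3 by trivial. destruct (HV X T HXT) as (_ & N & _). now field.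
Qed.

(** Inversion in x leaves the time variable unchanged, so T = kappa t is composed in afterwards:
    with k = 1/kappa to obtain V from xi, and with k = kappa to obtain xi from V. *)
Lemma rescaled_partials E f fx ft k : has_partials E f fx ft ->
  has_partials (fun x t => E x (k * t)) (fun x t => f x (k * t))
    (fun x t => fx x (k * t)) (fun x t => k * ft x (k * t)).
Proof.
intros H x t Hxt. destruct (H x (k * t) Hxt) as [H1 H2]. split; trivial.
apply (is_derive_comp (fun s => f x s) (fun t => k * t)); trivial.
auto_derive; trivial. ring.
Qed.

Lemma smooth_on_time_scale D k : open_2d D -> smooth_on D (fun _ t => k * t).
Proof. intros HD. apply (smooth_on_scal D k (fun _ t => t)); trivial.
now apply smooth_on_snd. Qed.

Lemma open_2d_rescaled E k : open_2d E -> open_2d (fun x t => E x (k * t)).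
Proof.
intros HE x t Hxt.
assert (H := open_2d_preimage _ E (fun x _ => x) (fun _ t => k * t) open_2d_full HE
  (smooth_on_continuous _ _ (smooth_on_fst _ open_2d_full))
  (smooth_on_continuous _ _ (smooth_on_time_scale _ k open_2d_full)) x t (conj I Hxt)).
apply locally_2d_impl with (2 := H), locally_2d_forall. now intros u v [_ K].
Qed.

Lemma smooth_on_rescaled E f k : open_2d E -> smooth_on E f ->
  smooth_on (fun x t => E x (k * t)) (fun x t => f x (k * t)).
Proof.
intros HE Hf. assert (HE' := open_2d_rescaled E k HE).
apply (smooth_on_comp _ E f (fun x _ => x) (fun _ t => k * t)); trivial.
- now apply smooth_on_fst.
- now apply smooth_on_time_scale.
Qed.

Lemma smooth_on_Schwarzian D u : open_2d D -> smooth_on D u ->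
  (forall x t, D x t -> dx 1 u x t <> 0) -> smooth_on D (Schwarzian u).
Proof.
intros HD Hu N.
assert (H1 := smooth_on_dx_n D u 1 Hu). assert (H2 := smooth_on_dx_n D u 2 Hu).
assert (H3 := smooth_on_dx_n D u 3 Hu).
apply smooth_on_ext with (fun x t => dx 3 u x t / dx 1 u x t - 3 / 2 * ((dx 2 u x t / dx 1 u
  x t) * (dx 2 u x t / dx 1 u x t))); trivial.
{ intros x t Hxt. unfold Schwarzian. specialize (N x t Hxt). now field. }
assert (Hq := smooth_on_div D _ _ HD H2 H1 N).
apply (smooth_on_minus D (fun x t => dx 3 u x t / dx 1 u x t)); trivial.
- now apply smooth_on_div.
- apply (smooth_on_scal D (3 / 2) (fun x t => (dx 2 u x t / dx 1 u x t) * (dx 2 u x t / dx 1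
    u x t))); trivial.
  now apply (smooth_on_mult D (fun x t => dx 2 u x t / dx 1 u x t)).
Qed.

Lemma is_derive_inv_pow2 (f : R -> R) x l : is_derive f x l -> f x <> 0 ->
  is_derive (fun y => / f y ^ 2) x (- 2 * l / f x ^ 3).
Proof.
intros H N. auto_derive.
- split; [now exists l|]. split; trivial. rewrite Rmult_1_r.
  now apply Rmult_integral_contrapositive.
- replace (Derive (fun y : R => f y) x) with l by (symmetry; now apply is_derive_unique).
  now field.
Qed.

Lemma dx_scal D c f n x t : open_2d D -> smooth_on D f -> D x t ->
  dx n (fun x t => c * f x t) x t = c * dx n f x t.
Proof.
intros HD Hf. revert x t. induction n as [|n IH]; intros x t Hxt; trivial.
apply (dx_succ_eq D _ (fun x t => c * dx n f x t)); trivial.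
apply (is_derive_scal (fun y => dx n f y t)). now apply (is_derive_dx D).
Qed.

(* The conservation law that makes [sqrt S[u] dx + (lambda/2) S[V] dt] closed. *)
Lemma sqrt_Schwarzian_conservation lambda D u : nonlinear_solution lambda D u ->
  let p := fun x t => / sqrt (Schwarzian u x t) in
  forall x t, D x t -> dt (fun x t => / p x t) x t = lambda / 2 * (p x t * dx 3 p x t).
Proof.
intros (HD & Hu & Heq) p.
assert (N : forall x t, D x t -> dx 1 u x t <> 0) by (intros; now apply Heq).
assert (HS := smooth_on_Schwarzian D u HD Hu N).
assert (P : forall x t, D x t -> 0 < Schwarzian u x t) by (intros; now apply Heq).
assert (Q : forall x t, D x t -> 0 < sqrt (Schwarzian u x t)) by (intros;
  now apply sqrt_lt_R0, P).
assert (Hp : smooth_on D p).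
{ apply smooth_on_inv; trivial; [now apply smooth_on_sqrt|]. intros x t Hxt.
  now apply Rgt_not_eq, Q. }
assert (Pp : forall x t, D x t -> 0 < p x t) by (intros; now apply Rinv_0_lt_compat, Q).
assert (ES : forall x t, D x t -> Schwarzian u x t = / p x t ^ 2).
{ intros x t Hxt. unfold p. rewrite pow_inv, Rinv_inv. symmetry. apply pow2_sqrt.
  now left; apply P. }
assert (Hw := smooth_on_scal D lambda p HD Hp).
assert (T := Schwarzian_transport D u _ HD Hu Hw N).
assert (Hu_t : forall x t, D x t -> dt u x t = lambda * p x t * dx 1 u x t).
{ intros x t Hxt. destruct (Heq x t Hxt) as (_ & _ & ->). unfold p. field.
  now apply Rgt_not_eq, Q. }
specialize (T Hu_t).
intros x t Hxt. specialize (T x t Hxt).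
rewrite 2!(dx_scal D) in T by trivial.
destruct (smooth_on_partials D p Hp x t Hxt) as [Dx Dt].
assert (Np : p x t <> 0) by (now apply Rgt_not_eq, Pp).
rewrite (dx_succ_eq D (Schwarzian u) (fun x t => / p x t ^ 2) 0 x t (- 2 * dx 1 p x t / p x t
  ^ 3) HD Hxt ES) in T
  by (now apply (is_derive_inv_pow2 (fun y => p y t))).
rewrite (dt_eq D (Schwarzian u) (fun x t => / p x t ^ 2) x t (- 2 * dt p x t / p x t ^ 3) HD
  Hxt ES) in T
  by (now apply (is_derive_inv_pow2 (fun s => p x s))).
rewrite ES in T by trivial.
(* With S = 1/p^2 and w = lambda p, the terms 2 w_x S and w S_x cancel, leaving -2 p_t/p^3 = lambda
   p_xxx: a Harry Dym equation for p. *)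
assert (Et : dt p x t = - (lambda / 2) * (p x t ^ 3 * dx 3 p x t)).
{ replace (dt p x t) with (- (p x t ^ 3 / 2) * (- 2 * dt p x t / p x t ^ 3)) by (now field).
  rewrite T. now field. }
apply is_derive_unique.
replace (lambda / 2 * (p x t * dx 3 p x t)) with (- dt p x t / p x t ^ 2) by (rewrite Et;
  now field).
now apply (is_derive_inv (fun s => p x s)).
Qed.

(** Taking xi as the potential of the closed form settles the additive function of t: xi_t is then
    exactly (lambda/2) S[V], with no remainder depending on t that would spoil the equation for
    V. *)
Theorem hodograph_direct kappa lambda mu a b c d u : kappa <> 0 -> kappa * mu = - lambda / 2 ->
  nonlinear_solution lambda (rectangle a b c d) u ->
  exists xi V, hodograph kappa (rectangle a b c d) u xi V /\
    SKdV_solution mu (hodograph_image kappa (rectangle a b c d) xi) V.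
Proof.
intros Hk Hkm Hsol. assert (Hsol' := Hsol). destruct Hsol' as (HD & Hu & Heq).
(* The potential needs a base point, so an empty rectangle is treated apart. *)
destruct (classic (exists x0 t0, rectangle a b c d x0 t0)) as [(x0 & t0 & H0)|Hempty].
2: { assert (E : forall x t, rectangle a b c d x t -> False) by (intros x t H; apply Hempty;
  now exists x, t).
  exists (fun _ _ => 0), (fun _ _ => 0). split; [split|split; [|split]].
  - intros x t H. now destruct (E x t).
  - intros x t H. now destruct (E x t).
  - intros X T (x & t & H & _). now destruct (E x t).
  - intros X T (x & t & H & _). now destruct (E x t).
  - intros X T (x & t & H & _). now destruct (E x t). }
set (D := rectangle a b c d) in *.
assert (N : forall x t, D x t -> dx 1 u x t <> 0) by (intros; now apply Heq).
assert (HS := smooth_on_Schwarzian D u HD Hu N).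
assert (P : forall x t, D x t -> 0 < Schwarzian u x t) by (intros; now apply Heq).
assert (Q : forall x t, D x t -> 0 < sqrt (Schwarzian u x t)) by (intros;
  now apply sqrt_lt_R0, P).
pose (p := fun x t => / sqrt (Schwarzian u x t)).
assert (Hp : smooth_on D p).
{ apply smooth_on_inv; trivial; [now apply smooth_on_sqrt|]. intros x t Hxt.
  now apply Rgt_not_eq, Q. }
assert (Pp : forall x t, D x t -> 0 < p x t) by (intros; now apply Rinv_0_lt_compat, Q).
assert (Np : forall x t, D x t -> p x t <> 0) by (intros; now apply Rgt_not_eq, Pp).
pose (h := fun x t => lambda / 2 * inverse_Schwarzian p x t).
assert (HI := smooth_on_inverse_Schwarzian D p HD Hp).
destruct (closed_form_potential a b c d x0 t0 (fun x t => / p x t) h) as (xi & Hxi & Pxi);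
  trivial.
{ now apply smooth_on_inv. }
{ now apply smooth_on_scal. }
{ intros x t Hxt. transitivity (lambda / 2 * (p x t * dx 3 p x t)).
  { exact (sqrt_Schwarzian_conservation lambda D u Hsol x t Hxt). }
  unfold h. rewrite (dx_scal D) by trivial. now rewrite (dx_inverse_Schwarzian D). }
assert (Dxi : forall x t, D x t -> dx 1 xi x t = / p x t /\ dt xi x t = h x t).
{ intros x t Hxt. exact (has_partials_unique D xi _ _ x t Pxi Hxt). }
assert (Gpos : forall y s, D y s -> 0 < dx 1 xi y s).
{ intros y s Hys. rewrite (proj1 (Dxi y s Hys)). now apply Rinv_0_lt_compat, Pp. }
set (H := slice_inverse a b c d xi).
set (Im := slice_image a b c d xi).
assert (HIm : open_2d Im) by now apply open_2d_slice_image.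
assert (HspecIm : forall x s, Im x s -> D (H x s) s /\ xi (H x s) s = x) by (intros;
  now apply slice_inverse_spec).
pose (k := / kappa). pose (V := fun X T => H X (k * T)).
assert (HO : forall X T, hodograph_image kappa D xi X T <-> Im X (k * T)).
{ intros X T. split.
  - intros (x & t & Hxt & -> & ->). exists x.
    replace (k * (kappa * t)) with t by (unfold k; now field). now split.
  - intros HXT. destruct (HspecIm _ _ HXT) as [K1 K2]. exists (H X (k * T)), (k * T).
    split; trivial. split; [now symmetry|]. unfold k. now field. }
assert (HIm' := open_2d_rescaled Im k HIm).
assert (PV := rescaled_partials Im H _ _ k (slice_inverse_partials a b c d xi Hxi Gpos)).
fold H V in PV.
exists xi, V. split; [split; trivial|split; [|split]].
- intros x t Hxt. split.
  + replace (sqrt (Schwarzian u x t)) with (/ p x t) by (apply Rinv_inv). now apply Pxi.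
  + unfold V. replace (k * (kappa * t)) with t by (unfold k; now field).
    now apply slice_inverseK.
- intros X T HXT. apply HO in HXT. apply locally_2d_impl with (2 := HIm' X T HXT),
    locally_2d_forall.
  intros u' v'. apply HO.
- apply smooth_on_subset with (fun X T => Im X (k * T)); [apply HO|].
  apply smooth_on_rescaled; trivial. now apply slice_inverse_smooth.
- assert (PV' : forall X T, Im X (k * T) -> D (V X T) (k * T) /\ p (V X T) (k * T) <> 0 /\
     is_derive (fun Y => V Y T) X (p (V X T) (k * T))).
  { intros X T HXT. destruct (HspecIm _ _ HXT) as [K1 K2].
    split; trivial. split; [now apply Np|].
    destruct (PV X T HXT) as [K3 _]. unfold V in K3 |- *.
    rewrite (proj1 (Dxi _ _ K1)), Rinv_inv in K3. exact K3. }
  intros X T HXT. apply HO in HXT. destruct (PV' X T HXT) as (K1 & K2 & K3).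
  rewrite (Schwarzian_inverse (fun X T => Im X (k * T)) D V p k HIm' Hp PV' X T HXT).
  assert (EX : dx 1 V X T = p (V X T) (k * T)) by now apply is_derive_unique.
  rewrite EX. split; [now apply Pp|].
  destruct (PV X T HXT) as [_ KT]. assert (ET := is_derive_unique _ _ _ KT).
  change (dt V X T = k * (- dt xi (V X T) (k * T) / dx 1 xi (V X T) (k * T))) in ET. rewrite ET.
  rewrite (proj1 (Dxi _ _ K1)), (proj2 (Dxi _ _ K1)). unfold h.
  replace mu with (- lambda / 2 / kappa) by (rewrite <- Hkm; now field).
  unfold k. field. now split.
Qed.

(** Two localisations occur: to a square in (X,T), whose slices are intervals on which V can be
    inverted, and then to a square in (x,t) on which the Riccati system is solvable. *)
Theorem hodograph_converse kappa lambda mu Omega V X0 T0 : kappa <> 0 ->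
  kappa * mu = - lambda / 2 -> SKdV_solution mu Omega V -> Omega X0 T0 ->
  exists (a b c d : Rbar) (u xi : R -> R -> R),
    nonlinear_solution lambda (rectangle a b c d) u /\
    hodograph kappa (rectangle a b c d) u xi V /\
    hodograph_image kappa (rectangle a b c d) xi X0 T0 /\
    (forall X T, hodograph_image kappa (rectangle a b c d) xi X T -> Omega X T).
Proof.
intros Hk Hkm (HO & HV & Heq) HX0.
destruct (HO X0 T0 HX0) as [e He].
set (E := square X0 T0 e).
assert (HEO : forall X T, E X T -> Omega X T).
{ intros X T HXT. apply squareE in HXT as [H1 H2]. now apply He. }
assert (HE0 : E X0 T0).
{ apply squareE. rewrite 2!Rminus_eq_0, Rabs_R0. split; apply cond_pos. }
assert (HE : open_2d E) by apply open_2d_rectangle.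
assert (HVE := smooth_on_subset E Omega V HEO HV).
assert (Vpos : forall X T, E X T -> 0 < dx 1 V X T) by (intros; now apply Heq, HEO).
set (H := slice_inverse (X0 - e) (X0 + e) (T0 - e) (T0 + e) V).
set (Im := slice_image (X0 - e) (X0 + e) (T0 - e) (T0 + e) V).
assert (HIm : open_2d Im) by now apply open_2d_slice_image.
assert (HspecIm : forall x s, Im x s -> E (H x s) s /\ V (H x s) s = x) by (intros;
  now apply slice_inverse_spec).
assert (HK : forall X T, E X T -> H (V X T) T = X) by (intros; now apply slice_inverseK).
pose (xi := fun x t => H x (kappa * t)).
pose (D := fun x t => Im x (kappa * t)).
assert (HD : open_2d D) by now apply open_2d_rescaled.
assert (Hxi : smooth_on D xi).
{ apply (smooth_on_rescaled Im H); trivial. now apply slice_inverse_smooth. }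
assert (Pxi := rescaled_partials Im H _ _ kappa (slice_inverse_partials _ _ _ _ V HVE Vpos)).
fold H xi D in Pxi.
assert (xiE : forall x t, D x t -> E (xi x t) (kappa * t) /\ V (xi x t) (kappa * t) = x) by
  (intros; now apply HspecIm).
pose (p := fun x t => dx 1 V (xi x t) (kappa * t)).
assert (Hp : smooth_on D p).
{ apply (smooth_on_comp D E (dx 1 V) xi (fun _ t => kappa * t)); trivial.
  - now apply smooth_on_dx.
  - intros x t Hxt. now apply xiE.
  - now apply smooth_on_time_scale. }
assert (Pp : forall x t, D x t -> 0 < p x t) by (intros; now apply Vpos, xiE).
assert (Np : forall x t, D x t -> p x t <> 0) by (intros; now apply Rgt_not_eq, Pp).
assert (DX : forall X T, E X T -> D (V X T) (/ kappa * T) /\ xi (V X T) (/ kappa * T) = X /\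
  kappa * (/ kappa * T) = T).
{ intros X T HXT. unfold D, xi. replace (kappa * (/ kappa * T)) with T by (now field).
  split; [now exists X|]. split; trivial. now apply HK. }
assert (SV : forall X T, E X T -> Schwarzian V X T = inverse_Schwarzian p (V X T) (/ kappa *
  T)).
{ apply (Schwarzian_inverse E D); trivial. intros X T HXT.
  destruct (DX X T HXT) as (K1 & K2 & K3).
  split; trivial. split; [now apply Np|]. unfold p. rewrite K2, K3.
  now apply (smooth_on_partials E). }
assert (xi_x : forall x t, D x t -> dx 1 xi x t = / p x t).
{ intros x t Hxt. exact (proj1 (has_partials_unique D xi _ _ x t Pxi Hxt)). }
assert (xi_t : forall x t, D x t -> dt xi x t = lambda / 2 * inverse_Schwarzian p x t).
{ intros x t Hxt. rewrite (proj2 (has_partials_unique D xi _ _ x t Pxi Hxt)).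
  destruct (xiE x t Hxt) as [K1 K2]. destruct (Heq _ _ (HEO _ _ K1)) as [_ K3].
  fold (xi x t). rewrite K3, (SV _ _ K1), K2.
  replace (/ kappa * (kappa * t)) with t by (now field).
  fold (p x t). replace (lambda / 2) with (- (kappa * mu)) by (rewrite Hkm; field).
  field. now apply Np. }
(* Commuting the derivatives of xi recovers the conservation law from the evolution of V; inverted,
   it is again the Harry Dym equation for p. *)
assert (q_t : forall x t, D x t -> dt (dx 1 xi) x t = lambda / 2 * (p x t * dx 3 p x t)).
{ intros x t Hxt. rewrite (dt_dx_comm D) by trivial.
  apply (dx_succ_eq D _ (fun x t => lambda / 2 * inverse_Schwarzian p x t)); trivial.
  apply (is_derive_scal (fun y => inverse_Schwarzian p y t)).
  rewrite <- (dx_inverse_Schwarzian D) by trivial.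
  apply (smooth_on_partials D); trivial. now apply smooth_on_inverse_Schwarzian. }
assert (p_t : forall x t, D x t -> dt p x t = - (lambda / 2) * (p x t ^ 3 * dx 3 p x t)).
{ intros x t Hxt. apply (dt_eq D p (fun x t => / dx 1 xi x t)); trivial.
  { intros y s Hys. now rewrite xi_x, Rinv_inv. }
  assert (K := smooth_on_partials D _ (smooth_on_dx D xi Hxi) x t Hxt).
  destruct K as [_ K]. rewrite q_t in K by trivial.
  replace (- (lambda / 2) * (p x t ^ 3 * dx 3 p x t)) with (- (lambda / 2 * (p x t * dx 3 p x
    t)) / (dx 1 xi x t) ^ 2).
  2: { rewrite xi_x by trivial. field. now apply Np. }
  apply (is_derive_inv (fun s => dx 1 xi x s)); trivial.
  rewrite xi_x by trivial. now apply Rinv_neq_0_compat, Np. }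
pose (A := fun x t => / p x t ^ 2). pose (w := fun x t => lambda * p x t).
assert (HA : smooth_on D A).
{ apply smooth_on_ext with (fun x t => / p x t * / p x t); trivial.
  - intros x t Hxt. unfold A. field. now apply Np.
  - assert (Hq := smooth_on_inv D p HD Hp Np). now apply smooth_on_mult. }
assert (Hw : smooth_on D w) by now apply smooth_on_scal.
assert (Compat : forall x t, D x t -> dt A x t = dx 3 w x t + 2 * dx 1 w x t * A x t + w x t
  * dx 1 A x t).
{ intros x t Hxt. destruct (smooth_on_partials D p Hp x t Hxt) as [K1 K2].
  assert (N := Np x t Hxt).
  replace (dt A x t) with (- 2 * dt p x t / p x t ^ 3)
    by (symmetry; apply is_derive_unique; now apply (is_derive_inv_pow2 (fun s => p x s))).
  replace (dx 1 A x t) with (- 2 * dx 1 p x t / p x t ^ 3)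
    by (symmetry; apply is_derive_unique; now apply (is_derive_inv_pow2 (fun y => p y t))).
  unfold w. rewrite 2!(dx_scal D), p_t by trivial. unfold A. now field. }
set (x0 := V X0 T0). set (t0 := / kappa * T0).
assert (D0 : D x0 t0) by now apply DX.
destruct (riccati_frobenius D A w x0 t0 HD D0 HA Hw Compat) as (r & z & Hr & HQD & Hz & Pz).
set (Q := square x0 t0 r) in *.
assert (HQ : open_2d Q) by apply open_2d_rectangle.
assert (Q0 : Q x0 t0).
{ apply squareE. rewrite 2!Rminus_eq_0, Rabs_R0. now split. }
assert (HwQ := smooth_on_subset Q D w HQD Hw).
assert (Hw1 := smooth_on_dx Q w HwQ).
(* [rho] plays the role of log u_x: u_t = w u_x requires (log u_x)_t = w_x + w z, and the t-equation
   of z is precisely the closedness of z dx + (w_x + w z) dt. *)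
destruct (closed_form_potential _ _ _ _ x0 t0 z (fun x t => dx 1 w x t + w x t * z x t) Q0)
  as (rho & Hrho & Prho); trivial.
{ apply (smooth_on_plus Q (dx 1 w) (fun x t => w x t * z x t)); trivial.
  now apply smooth_on_mult. }
{ intros x t Hxt. destruct (has_partials_unique _ _ _ _ x t Pz Hxt) as [_ ->]. symmetry.
  apply is_derive_unique. unfold riccati_t. rewrite Rplus_assoc.
  apply (is_derive_plus (fun y => dx 1 w y t) (fun y => w y t * z y t)).
  - now apply (is_derive_dx Q w 1).
  - apply (is_derive_mult (fun y => w y t) (fun y => z y t)).
    + exact (is_derive_dx Q w 0 x t HwQ Hxt).
    + now apply Pz.
    + exact Rmult_comm. }
assert (Hexp := smooth_on_exp Q rho HQ Hrho).
assert (Pexp : has_partials Q (fun x t => exp (rho x t)) (fun x t => z x t * exp (rho x t))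
   (fun x t => (dx 1 w x t + w x t * z x t) * exp (rho x t))).
{ intros x t Hxt. destruct (Prho x t Hxt) as [K1 K2]. split.
  - apply (is_derive_comp exp (fun y => rho y t)); trivial. apply is_derive_exp.
  - apply (is_derive_comp exp (fun s => rho x s)); trivial. apply is_derive_exp. }
(* The form exp(rho) dx + w exp(rho) dt is closed because both mixed derivatives equal (w_x + w z)
   exp(rho); its potential has u_x > 0 and u_t = w u_x. *)
destruct (closed_form_potential _ _ _ _ x0 t0 (fun x t => exp (rho x t)) (fun x t => w x t *
  exp (rho x t)) Q0)
  as (u & Hu & Pu); trivial.
{ now apply (smooth_on_mult Q w (fun x t => exp (rho x t))). }
{ intros x t Hxt. destruct (has_partials_unique _ _ _ _ x t Pexp Hxt) as [_ ->]. symmetry.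
  apply is_derive_unique. rewrite Rmult_plus_distr_r, Rmult_assoc.
  apply (is_derive_mult (fun y => w y t) (fun y => exp (rho y t))).
  - exact (is_derive_dx Q w 0 x t HwQ Hxt).
  - now apply Pexp.
  - exact Rmult_comm. }
fold (square x0 t0 r) Q in Hu, Pu.
assert (u1 : forall x t, Q x t -> dx 1 u x t = exp (rho x t)).
{ intros x t Hxt. now apply (has_partials_unique _ _ _ _ x t Pu). }
assert (u2 : forall x t, Q x t -> dx 2 u x t = z x t * exp (rho x t)).
{ intros x t Hxt. apply (dx_succ_eq Q u (fun x t => exp (rho x t)) 1); trivial.
  now apply Pexp. }
assert (u3 : forall x t, Q x t -> dx 3 u x t = (A x t + z x t ^ 2 / 2) * exp (rho x t) + z x
  t * (z x t * exp (rho x t))).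
{ intros x t Hxt. apply (dx_succ_eq Q u (fun x t => z x t * exp (rho x t)) 2); trivial.
  apply (is_derive_mult (fun y => z y t) (fun y => exp (rho y t))).
  - now apply Pz.
  - now apply Pexp.
  - exact Rmult_comm. }
assert (Su : forall x t, Q x t -> Schwarzian u x t = (/ p x t) ^ 2).
{ intros x t Hxt. unfold Schwarzian. rewrite u1, u2, u3, pow_inv by trivial. unfold A.
  assert (Ne := Rgt_not_eq _ _ (exp_pos (rho x t))). field. split; trivial. now apply Np, HQD. }
assert (Pip : forall x t, Q x t -> 0 < / p x t) by (intros;
  now apply Rinv_0_lt_compat, Pp, HQD).
assert (sqrtS : forall x t, Q x t -> sqrt (Schwarzian u x t) = / p x t).
{ intros x t Hxt. rewrite Su by trivial. apply sqrt_pow2. now left; apply Pip. }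
exists (x0 - r), (x0 + r), (t0 - r), (t0 + r), u, xi.
fold (square x0 t0 r) Q. split; [split; [|split]|split; [split|split]]; trivial.
- intros x t Hxt. rewrite u1, sqrtS by trivial. split; [apply Rgt_not_eq, exp_pos|]. split.
  + rewrite Su by trivial. now apply pow_lt, Pip.
  + rewrite (proj2 (has_partials_unique _ _ _ _ x t Pu Hxt)). unfold w. field.
    now apply Np, HQD.
- now apply smooth_on_subset with D.
- intros x t Hxt. rewrite sqrtS by trivial. split.
  + rewrite <- xi_x by now apply HQD. exact (is_derive_dx D xi 0 x t Hxi (HQD x t Hxt)).
  + now apply xiE, HQD.
- exists x0, t0. split; trivial. destruct (DX X0 T0 HE0) as (_ & K2 & K3). now split; symmetry.
- intros X T (x & t & Hxt & -> & ->). now apply HEO, xiE, HQD.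
Qed.

(* Under X = int sqrt(S[u]) dx, T = t, V = x, the equation
   u_t = lambda u_x / sqrt(S[u]) corresponds to V_T = -(lambda/2) V_X S[V]
   (which is V_T = V_X S[V] verbatim when lambda = -2); measuring the new time
   as T = -(lambda/2) t, it corresponds to V_T = V_X S[V] for every lambda. *)
Theorem mainTheorem6 (lambda : R) (hlambda : lambda <> 0) :
  hodograph_maps_between 1 lambda (- lambda / 2) /\
  hodograph_maps_between (- lambda / 2) lambda 1.
Proof.
(* Both pairs (kappa, mu) have product -lambda/2; in the second, kappa is nonzero by [hlambda]. *)
split; split; intros; [eapply hodograph_direct|eapply hodograph_converse|eapply
  hodograph_direct|eapply hodograph_converse];
  try eassumption; lra.
Qed.
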